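(* The Kepler vector field $X_H$ (on the part of $TS^3$ where $E<0$) and the Delaunay vector field $X_{\mathcal H}$ are $C^\infty$-equivalent with maps $$\Phi(q,v)=\big(\alpha\sin\varphi+\beta\cos\varphi,\ \nu(-\alpha\cos\varphi+\beta\sin\varphi)\big)$$ and $$\tau_q=\int_{t_0}^{t}\frac{dt}{q_0^2(t)},$$ where $\varphi=\frac{1}{\nu q_0}\,\boldsymbol q\cdot\boldsymbol\pi\ (=\alpha_0)$.
   Context: Notation: $\langle\cdot,\cdot\rangle$ is the Euclidean inner product on $\mathbb{R}^4$; $\cdot$, $\times$, $|\cdot|$ are the dot product, cross product and norm on $\mathbb{R}^3$. Write $q=(q_0,\boldsymbol q)$, $v=(v_0,\boldsymbol v)\in\mathbb{R}\times\mathbb{R}^3$, and $TS^3=\{(q,v):\langle q,q\rangle=1,\ \langle q,v\rangle=0\}$. The constant $\gamma>0$ is fixed. The Kepler vector field $X_H$ on $TS^3$ is the Hamiltonian vector field, for the restriction to $TS^3$ of $\sum_{i=0}^3 dq_i\wedge dv_i$, of the restriction of $H(q,v)=\frac12\langle v,v\rangle-\gamma\frac{q_0}{(1-q_0^2)^{1/2}}$; explicitly $$\dot q=v,\qquad \dot v=\frac{\gamma e_0}{(1-q_0^2)^{3/2}}-\Big(\langle v,v\rangle+\gamma\frac{q_0}{(1-q_0^2)^{3/2}}\Big)q,\qquad e_0=(1,0,0,0).$$ Set $\boldsymbol\mu=\boldsymbol q\times\boldsymbol v$, $\boldsymbol\pi=q_0\boldsymbol v-v_0\boldsymbol q$, and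 $E=H-\frac12|\boldsymbol\mu|^2=\frac12|\boldsymbol\pi|^2-\gamma\frac{q_0}{(1-q_0^2)^{1/2}}$, a constant of motion; $E<0$ forces $q_0>0$. Set $\nu=\gamma/\sqrt{-2E}$ and $$\alpha=(\alpha_0,\boldsymbol\alpha)=\Big(\frac{1}{\nu q_0}\,\boldsymbol q\cdot\boldsymbol\pi,\ \frac{\boldsymbol q}{|\boldsymbol q|}-\frac{\boldsymbol q\cdot\boldsymbol\pi}{\gamma q_0}\boldsymbol\pi\Big),\qquad \beta=(\beta_0,\boldsymbol\beta)=\Big(\frac{|\boldsymbol q|}{\gamma q_0}\boldsymbol\pi\cdot\boldsymbol\pi-1,\ \frac{|\boldsymbol q|}{\nu q_0}\boldsymbol\pi\Big).$$ In the formula for $\tau_q$, $q_0(t)$ is taken along an integral curve $(q(t),v(t))$ of $X_H$. On $T^+S^3=\{(x,y)\in\mathbb{R}^4\times\mathbb{R}^4:\langle x,x\rangle=1,\ \langle x,y\rangle=0,\ y\neq0\}$ with the restriction of the standard symplectic form, the Delaunay Hamiltonian is $\mathcal H=-\frac12\frac{\gamma^2}{\langle y,y\rangle}$; its Hamiltonian vector field, the Delaunay vector field $X_{\mathcal H}$, has integral curves satisfying $\frac{dx}{dt}=\frac{\gamma^2}{\langle y,y\rangle^2}y$, $\frac{dy}{dt}=-\frac{\gamma^2}{\langle y,y\rangle}x$. Definition: let $X$ and $Y$ be vector fields on manifolds $M$ and $N$, with corresponding flows $g^X_t:M\to M$ and $g^Y_t:N\to N$. They are $C^k$-equivalent if there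 is a $C^k$-diffeomorphism $\Phi:M\to N$ that maps the orbits of $g^X$ onto the orbits of $g^Y$ and preserves the direction of time; that is, there is a family of monotone increasing diffeomorphisms $\tau_x:\mathbb{R}\to\mathbb{R}$ such that $\Phi(g^X_t(x))=g^Y_{\tau_x(t)}(\Phi(x))$.
   Formalization: Since Φ misses the fibre x = e_0 and collision orbits (μ = 0) end in finite time, the target is T^+S^3 without that fibre, flows are maximal local flows, and τ_x maps maximal time intervals onto each other; these are all of R when μ ≠ 0. *)

(* Defs.v *)
From HB Require Import structures.
From mathcomp Require Import all_boot all_order all_algebra.
From mathcomp Require Import all_classical all_reals all_analysis.
From mathcomp Require Import ring.
Set Implicit Arguments.
Unset Strict Implicit.
Unset Printing Implicit Defensive.
Import Order.TTheory GRing.Theory Num.Theory numFieldNormedType.Exports.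
Local Open Scope classical_set_scope.
Local Open Scope ring_scope.

(** ** Smooth maps between embedded submanifolds *)

(* Intended for finite-dimensional V and W, where differentiability together
   with C^k directional differentials in all directions is the usual C^(k+1). *)
Fixpoint Ck (R : realType) (V W : normedModType R) (k : nat) (U : set V)
    (f : V -> W) : Prop :=
  if k is k'.+1 then
    (forall x, U x -> differentiable f x) /\
    (forall v : V, Ck k' U (fun x => 'd f x v))
  else forall x, U x -> {for x, continuous f}.

(* Manifolds are represented as subsets of a finite-dimensional space; a map on
   such a subset is smooth when it extends smoothly to an ambient neighbourhood
   of each point. *)
Definition smooth_map (R : realType) (V W : normedModType R) (A : set V)
    (f : V -> W) : Prop :=
  forall x, A x -> exists (U : set V) (g : V -> W),
    [/\ open_nbhs x U, forall k, Ck k U g & forall y, A y -> U y -> f y = g y].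

Definition diffeomorphism (R : realType) (V W : normedModType R)
    (A : set V) (B : set W) (f : V -> W) : Prop :=
  [/\ set_bij A B f, smooth_map A f &
      exists g : W -> V, (forall x, A x -> g (f x) = x) /\ smooth_map B g].

(** ** Flows of not necessarily complete vector fields *)

Definition integral_curve (R : realType) (V : normedModType R) (M : set V)
    (X : V -> V) (J : set R) (c : R -> V) : Prop :=
  [/\ open J, is_interval J &
      forall t, J t -> M (c t) /\ is_derive t (1 : R) c (X (c t))].

(* For x in M, [g x] is the integral curve of X in M through x at
   time 0, defined on the maximal interval [D x]. *)
Definition is_flow (R : realType) (V : normedModType R) (M : set V)
    (X : V -> V) (D : V -> set R) (g : V -> R -> V) : Prop :=
  forall x, M x ->
    [/\ D x 0, g x 0 = x, integral_curve M X (D x) (g x) &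
        forall J c, integral_curve M X J c -> J 0 -> c 0 = x ->
          J `<=` D x /\ (forall t, J t -> c t = g x t)].

Definition orbit (R : realType) (V : normedModType R) (D : V -> set R)
    (g : V -> R -> V) (x : V) : set V := g x @` D x.

(* For complete flows, i.e. DX x = DY y = setT, every [tau x] is an increasing
   diffeomorphism of the real line. *)
Definition smooth_equivalence (R : realType) (V W : normedModType R)
    (M : set V) (DX : V -> set R) (gX : V -> R -> V)
    (N : set W) (DY : W -> set R) (gY : W -> R -> W)
    (Phi : V -> W) (tau : V -> R -> R) : Prop :=
  [/\ diffeomorphism M N Phi,
      forall x, M x -> Phi @` orbit DX gX x = orbit DY gY (Phi x) &
      forall x, M x ->
        [/\ diffeomorphism (DX x) (DY (Phi x)) (tau x),
            forall s t, DX x s -> DX x t -> s < t -> tau x s < tau x t &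
            forall t, DX x t -> Phi (gX x t) = gY (Phi x) (tau x t)]].

Definition oriented_integral (R : realType) (a b : R) (f : R -> R) : R :=
  if a <= b then \int[@lebesgue_measure R]_(s in `[a, b]) f s
  else - \int[@lebesgue_measure R]_(s in `[b, a]) f s.

(** ** Euclidean geometry *)

(* R^4 as R x R^3: a point q is (q_0, bold q) = (q.1, q.2). *)
Notation vec4 R := (R * 'rV[R]_3)%type.
Notation phase R := (vec4 R * vec4 R)%type.

Definition dot (R : realType) (u w : 'rV[R]_3) : R := \sum_i u 0 i * w 0 i.

Definition norm3 (R : realType) (u : 'rV[R]_3) : R := Num.sqrt (dot u u).

(* Indices are taken cyclically, in Z/3Z. *)
Definition cross (R : realType) (u w : 'rV[R]_3) : 'rV[R]_3 :=
  \row_(i < 3) (u 0 (i + 1) * w 0 (i + 2) - u 0 (i + 2) * w 0 (i + 1)).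

Definition inner (R : realType) (x y : vec4 R) : R :=
  x.1 * y.1 + dot x.2 y.2.

Definition e0 (R : realType) : vec4 R := (1, 0).

Definition TS3 (R : realType) : set (phase R) :=
  [set z | inner z.1 z.1 = 1 /\ inner z.1 z.2 = 0].

Definition TplusS3 (R : realType) : set (phase R) :=
  [set z | TS3 z /\ z.2 != 0].

(** ** Hamiltonian vector fields on TS^3 *)

Definition omega (R : realType) (w w' : phase R) : R :=
  inner w.1 w'.2 - inner w.2 w'.1.

Definition tangent_TS3 (R : realType) (z w : phase R) : Prop :=
  inner z.1 w.1 = 0 /\ inner w.1 z.2 + inner z.1 w.2 = 0.

Definition hamiltonian_field (R : realType) (M : set (phase R))
    (H : phase R -> R) (X : phase R -> phase R) : Prop :=
  forall z, M z -> tangent_TS3 z (X z) /\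
    forall w, tangent_TS3 z w -> is_derive z w H (omega (X z) w).

(** ** The Kepler problem on S^3 *)

Definition kepler_H (R : realType) (gamma : R) (z : phase R) : R :=
  let: (q, v) := z in
  inner v v / 2 - gamma * (q.1 / Num.sqrt (1 - q.1 ^+ 2)).

Definition kepler_X (R : realType) (gamma : R) (z : phase R) : phase R :=
  let: (q, v) := z in
  let d := Num.sqrt (1 - q.1 ^+ 2) ^+ 3 in
  (v, (gamma / d) *: e0 R - (inner v v + gamma * (q.1 / d)) *: q).

Definition mu (R : realType) (z : phase R) : 'rV[R]_3 := cross z.1.2 z.2.2.

Definition pi_ (R : realType) (z : phase R) : 'rV[R]_3 :=
  let: (q, v) := z in q.1 *: v.2 - v.1 *: q.2.

Definition energy (R : realType) (gamma : R) (z : phase R) : R :=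
  kepler_H gamma z - dot (mu z) (mu z) / 2.

(* The condition q <> +-e_0 removes the poles of the potential. *)
Definition kepler_domain (R : realType) : set (phase R) :=
  [set z | TS3 z /\ z.1.1 ^+ 2 != 1].

Definition kepler_neg (R : realType) (gamma : R) : set (phase R) :=
  [set z | kepler_domain z /\ energy gamma z < 0].

Definition nu (R : realType) (gamma : R) (z : phase R) : R :=
  gamma / Num.sqrt (- 2 * energy gamma z).

Definition alpha (R : realType) (gamma : R) (z : phase R) : vec4 R :=
  let q := z.1 in let p := pi_ z in
  ((nu gamma z * q.1)^-1 * dot q.2 p,
   (norm3 q.2)^-1 *: q.2 - (dot q.2 p / (gamma * q.1)) *: p).

Definition beta (R : realType) (gamma : R) (z : phase R) : vec4 R :=
  let q := z.1 in let p := pi_ z in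
  (norm3 q.2 / (gamma * q.1) * dot p p - 1,
   (norm3 q.2 / (nu gamma z * q.1)) *: p).

Definition phi (R : realType) (gamma : R) (z : phase R) : R :=
  (nu gamma z * z.1.1)^-1 * dot z.1.2 (pi_ z).

Definition Phi (R : realType) (gamma : R) (z : phase R) : phase R :=
  let a := alpha gamma z in let b := beta gamma z in let f := phi gamma z in
  (sin f *: a + cos f *: b, nu gamma z *: (- (cos f *: a) + sin f *: b)).

(* The time change along a curve c in phase space, from the initial time t0. *)
Definition tau_along (R : realType) (c : R -> phase R) (t0 t : R) : R :=
  oriented_integral t0 t (fun s => ((c s).1.1 ^+ 2)^-1).

(** ** The Delaunay vector field *)

Definition delaunay_H (R : realType) (gamma : R) (z : phase R) : R :=
  - (gamma ^+ 2 / inner z.2 z.2) / 2.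

Definition delaunay_X (R : realType) (gamma : R) (z : phase R) : phase R :=
  let: (x, y) := z in
  ((gamma ^+ 2 / inner y y ^+ 2) *: y, - (gamma ^+ 2 / inner y y) *: x).

(* T^+S^3 without the fibre over the pole e_0: that fibre corresponds to the
   collisions q = e_0, at which kepler_X is undefined. *)
Definition delaunay_domain (R : realType) : set (phase R) :=
  [set z | TplusS3 z /\ z.1 != e0 R].

(** ** The explicit vector fields are the Hamiltonian ones *)

Lemma is_derive_line (R : realType) (V : normedModType R) (H : V -> R)
    (z w : V) (l : R) :
  is_derive (0 : R) (1 : R) (fun s => H (s *: w + z)) l -> is_derive z w H l.
Proof.
have E : (fun h : R => h^-1 *: (((fun s => H (s *: w + z)) \o shift 0) (h *: (1 : R))
            - H (0 *: w + z))) = (fun h => h^-1 *: ((H \o shift z) (h *: w) - H z)).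
  by apply/funext => h /=; rewrite addr0 scale0r add0r -[h *: 1]/(h * 1) mulr1.
by case=> D e; split; move: D e; rewrite /derivable /derive E.
Qed.

Lemma dotC (R : realType) (u w : 'rV[R]_3) : dot u w = dot w u.
Proof. by apply: eq_bigr => i _; rewrite mulrC. Qed.

Lemma dotDl (R : realType) (a : R) (u w x : 'rV[R]_3) :
  dot (a *: u + w) x = a * dot u x + dot w x.
Proof.
rewrite /dot mulr_sumr -big_split /=; apply: eq_bigr => i _.
by rewrite !mxE; ring.
Qed.

Lemma innerC (R : realType) (x y : vec4 R) : inner x y = inner y x.
Proof. by rewrite /inner dotC mulrC. Qed.

Lemma innerDl (R : realType) (a : R) (x y z : vec4 R) :
  inner (a *: x + y) z = a * inner x z + inner y z.
Proof. by rewrite /inner /= dotDl /GRing.scale /=; ring. Qed.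

Lemma innerZl (R : realType) (a : R) (x z : vec4 R) :
  inner (a *: x) z = a * inner x z.
Proof.
rewrite -[a *: x]addr0 innerDl; suff -> : inner 0 z = 0 by rewrite addr0.
by rewrite /inner /= mul0r add0r /dot big1 // => i _; rewrite mxE mul0r.
Qed.

Lemma inner_line (R : realType) (y w : vec4 R) (s : R) :
  inner (s *: w + y) (s *: w + y) =
  inner y y + s * (2 * inner y w) + s ^+ 2 * inner w w.
Proof.
by rewrite innerDl ![inner _ (_ + _)]innerC !innerDl (innerC w y); ring.
Qed.

Lemma inner_gt0 (R : realType) (y : vec4 R) : y != 0 -> 0 < inner y y.
Proof.
move=> y0; rewrite lt_neqAle eq_sym; apply/andP; split; last first.
  by rewrite addr_ge0 ?sumr_ge0 -?expr2 ?sqr_ge0 // => i _; rewrite -expr2 sqr_ge0.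
apply: contra y0; have d0 : 0 <= dot y.2 y.2.
  by apply: sumr_ge0 => i _; rewrite -expr2 sqr_ge0.
rewrite /inner paddr_eq0 // -?expr2 ?sqr_ge0 // sqrf_eq0 => /andP[/eqP y1].
rewrite /dot psumr_eq0; last by move=> i _; rewrite -expr2 sqr_ge0.
move=> /allP y2; rewrite (surjective_pairing y) y1 xpair_eqE eqxx /=.
apply/eqP/rowP => i; rewrite mxE; have := y2 i (mem_index_enum i).
by rewrite -expr2 sqrf_eq0 => /eqP.
Qed.


Lemma kepler_X_hamiltonian (R : realType) (gamma : R) :
  hamiltonian_field (@kepler_domain R) (kepler_H gamma) (kepler_X gamma).
Proof.
move=> [q v] [[/= qq qv] q1]; rewrite /kepler_X.
have h0 : 0 < 1 - q.1 ^+ 2.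
  rewrite subr_gt0 lt_neqAle q1 /= -qq /inner expr2 lerDl.
  by apply: sumr_ge0 => i _; rewrite -expr2 sqr_ge0.
have sgt0 : 0 < Num.sqrt (1 - q.1 ^+ 2) by rewrite sqrtr_gt0.
have sE : Num.sqrt (1 - q.1 ^+ 2) ^+ 2 = 1 - q.1 ^+ 2 by rewrite sqr_sqrtr ?ltW.
have innere0 x : inner (e0 R) x = x.1.
  rewrite /inner /= mul1r -[RHS]addr0; congr (_ + _).
  by rewrite /dot big1 // => i _; rewrite mxE mul0r.
split.
  split=> //=; rewrite innerC innerDl -[- (_ *: q)]scaleNr !innerZl innere0 qq; field.
  exact: lt0r_neq0.
move=> [w1 w2] [/= qw vw]; apply: is_derive_line.
rewrite /kepler_H /=.
under [X in is_derive _ _ X _]eq_fun do rewrite inner_line.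
set g := fun s : R => 1 - (s *: w1.1 + q.1) ^+ 2.
have gE : g 0 = 1 - q.1 ^+ 2 by rewrite /g scale0r add0r.
have Dg : is_derive (0 : R) (1 : R) g (- (2 * q.1 * w1.1)).
  apply: is_derive_eq; rewrite /GRing.scale /= !mul0r; ring.
have Ds : is_derive (0 : R) (1 : R) (Num.sqrt \o g)
    ((2 * Num.sqrt (g 0))^-1 * - (2 * q.1 * w1.1)).
  by apply: is_derive1_comp; apply: is_derive1_sqrt; rewrite gE.
have s0 : (Num.sqrt \o g) 0 != 0 by rewrite /= gE lt0r_neq0.
have DV := @is_deriveV _ _ _ _ _ s0 Ds.
have -> : (fun s : R => (inner v v + s * (2 * inner v w2) +
      s ^+ 2 * inner w2 w2) / 2
      - gamma * ((s *: w1 + q).1 / Num.sqrt (1 - (s *: w1 + q).1 ^+ 2))) =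
    (fun s : R => (inner v v + s * (2 * inner v w2) +
      s ^+ 2 * inner w2 w2) / 2 
      - gamma * ((s * w1.1 + q.1) * ((Num.sqrt \o g) s)^-1)) by [].
apply: is_derive_eq.
have -> : omega (v, (gamma / Num.sqrt (1 - q.1 ^+ 2) ^+ 3) *: e0 R -
    (inner v v + gamma * (q.1 / Num.sqrt (1 - q.1 ^+ 2) ^+ 3)) *: q) (w1, w2) =
    inner v w2 - gamma / Num.sqrt (1 - q.1 ^+ 2) ^+ 3 * w1.1.
  rewrite /omega /= innerDl -[- (_ *: q)]scaleNr !innerZl innere0 qw.
  by rewrite mulr0 addr0.
rewrite /= gE /GRing.scale /= !mul0r !mulr0 ?expr0n /= !(mulr0, mul0r, addr0, add0r, mulr1).
set t := Num.sqrt _ in sgt0 sE *.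
have -> : gamma / t ^+ 3 * w1.1 = gamma / t ^+ 3 * (t ^+ 2 + q.1 ^+ 2) * w1.1.
  by rewrite sE subrK mulr1.
field; exact: lt0r_neq0.
Qed.

Lemma delaunay_X_hamiltonian (R : realType) (gamma : R) :
  hamiltonian_field (@TplusS3 R) (delaunay_H gamma) (delaunay_X gamma).
Proof.
move=> [x y] [[/= xx xy] y0]; rewrite /delaunay_X.
have yy := inner_gt0 y0.
split.
  split=> /=; first by rewrite innerC innerZl innerC xy mulr0.
  rewrite innerZl ![inner x _]innerC innerZl xx; field; exact: lt0r_neq0.
move=> [w1 w2] [/= xw yw]; apply: is_derive_line.
rewrite /delaunay_H /=.
have -> : omega (gamma ^+ 2 / inner y y ^+ 2 *: y,
    - (gamma ^+ 2 / inner y y) *: x) (w1, w2)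
    = gamma ^+ 2 / inner y y ^+ 2 * inner y w2.
  by rewrite /omega /= !innerZl xw mulr0 subr0.
under [X in is_derive _ _ X _]eq_fun do rewrite inner_line.
have h : (inner y y + 0 * (2 * inner y w2) + 0 ^+ 2 * inner w2 w2) != 0.
  by rewrite !mul0r expr0n /= mul0r !addr0 lt0r_neq0.
apply: is_derive_eq; rewrite /GRing.scale /= !mul0r expr0n /=.
field; exact: lt0r_neq0.
Qed.

(* Main.v *)
Require Import Defs.
From HB Require Import structures.
From mathcomp Require Import all_boot all_order all_algebra.
From mathcomp Require Import all_classical all_reals all_analysis.
From mathcomp Require Import ring lra.
Set Implicit Arguments.
Unset Strict Implicit.
Unset Printing Implicit Defensive.
Import Order.TTheory GRing.Theory Num.Theory numFieldNormedType.Exports.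
Local Open Scope classical_set_scope.
Local Open Scope ring_scope.

(** Central (gnomonic) projection from the hemisphere [q_0 > 0], with position
    [x = q / q_0], momentum [p = pi] and time [ds = dt / q_0 ^+ 2], turns the
    Kepler problem on the sphere into the Euclidean Kepler problem
    [x' = p], [p' = - gamma x / |x|^3], and [energy] into the Euclidean
    energy.  In these variables [Phi] is the Ligon-Schaaf map: along a motion
    the orthonormal pair [(alpha, beta)] turns at the rate [gamma / (nu |x|)],
    the angle [phi = alpha_0] grows at [beta_0] times that rate, and since
    [beta_0 = 1 - gamma |x| / nu ^+ 2] the pair turned by [phi], which is
    [Phi], rotates at the constant Delaunay frequency [gamma ^+ 2 / nu ^+ 3]
    ([kepler_Phi]).

    To invert [Phi] one must recover [phi] from its value [(X, Y)].  The first
    coordinate of [alpha = X sin phi - (Y / nu) cos phi] equals [phi], so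
    [phi] solves Kepler's equation with coefficients [X_0] and [Y_0 / nu].  By
    Bessel's inequality the eccentricity is at most one; the equation is then
    strictly monotone, and nondegenerate unless [X] is the pole [e0]
    ([kepler_sol_nondeg]).  Its solution is smooth ([Ck_kepler_sol]), [alpha],
    [beta] and then the Kepler state are explicit in it, and this inverse
    [Psi] carries Delaunay curves to Kepler curves by a similar computation
    ([is_derive_Psi]).

    The Delaunay flow is a rotation of the pair [(X, Y / nu)], stopped at the
    pole.  Both existence and uniqueness of Kepler curves are read off from it.
    The image under [Phi] of any Kepler curve, rotated back by its own angle,
    is constant ([delaunay_reparam]), so the curve is determined by its
    starting point and the time change; conversely [Psi] of a rotation,
    reparametrised by the inverse of [s |-> \int_0^s q_0 ^+ 2], is a Kepler
    curve.  This yields the maximal Kepler flow together with the claimed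
    conjugation.  If [mu] does not vanish, neither does the corresponding
    bivector of [(X, Y)], the great circle avoids the pole, and boundedness of
    [x] makes the time change a bijection of the whole line. *)

(** * Calculus of C^k maps on open sets *)

Section Smooth.
Context {R : realType}.

Section CkGeneral.
Context {V : normedModType R}.
Implicit Types (U : set V) (k : nat).

Lemma near_eq_diff (W : normedModType R) (f g : V -> W) (x : V) :
  (\forall y \near x, f y = g y) -> differentiable f x ->
  differentiable g x /\ 'd g x = 'd f x :> (V -> W).
Proof.
move=> fg df; have dfc : continuous ('d f x) by exact: diff_continuous.
have E : g \o shift x = cst (g x) + 'd f x +o_ 0 id.
  apply/eqaddoP => e e0; have /eqaddoP /(_ e e0) := diff_locally df.
  apply: filterS2; last first.
    have : \forall h \near 0, f (h + x) = g (h + x).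
      by move: fg; rewrite (near_shift 0) subr0.
    exact.
  move=> h /= fgh; rewrite /= !fctE /= fgh.
  by rewrite (nbhs_singleton fg).
have dE : 'd g x = 'd f x :> (V -> W) by exact: diff_unique.
split; last exact: dE.
apply/diff_locallyP; split; [rewrite dE|rewrite dE].
  exact: dfc.
exact: E.
Qed.

Lemma Ck_eq (W : normedModType R) k U (f g : V -> W) : open U ->
  (forall x, U x -> f x = g x) -> Ck k U f -> Ck k U g.
Proof.
move=> oU; have near_U x : U x -> \forall y \near x, U y.
  by move=> Ux; apply: open_nbhs_nbhs; split.
elim: k f g => [|k IH] f g fg /=.
  move=> cf x Ux; have : f y @[y --> x] --> f x by exact: cf.
  rewrite (fg _ Ux) ; apply: cvg_trans.
  apply: near_eq_cvg; apply: filterS (near_U _ Ux) => y Uy.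
  exact: fg.
have nfg x : U x -> \forall y \near x, f y = g y.
  by move=> Ux; apply: filterS (near_U _ Ux).
move=> [df cf]; split=> [x Ux|v]; first by have [] := near_eq_diff (nfg _ Ux) (df _ Ux).
apply: IH (cf v) => x Ux.
by have [_ ->] := near_eq_diff (nfg _ Ux) (df _ Ux).
Qed.

Lemma CkW (W : normedModType R) k U (f : V -> W) : Ck k.+1 U f -> Ck k U f.
Proof.
elim: k f => [|k IH] f [df cf].
  by move=> x Ux; apply/differentiable_continuous/df.
by split=> // v; apply: IH (cf v).
Qed.

Lemma Ck_cst (W : normedModType R) k U (a : W) : Ck k U (fun=> a).
Proof.
elim: k a => [|k IH] a /=; first by move=> x _; exact: cst_continuous.
split=> [x _|v]; first exact: differentiable_cst.
rewrite (_ : (fun x => _) = fun=> 0); first exact: IH.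
by apply/funext => x; rewrite (diff_cst a).
Qed.

Lemma Ck_lin (W : normedModType R) k U (f : {linear V -> W}) :
  continuous f -> Ck k U f.
Proof.
move=> cf; case: k => [|k] /=; first by move=> x _; exact: cf.
split=> [x _|v]; first exact: linear_differentiable.
rewrite (_ : (fun x => _) = fun=> f v); first exact: Ck_cst.
by apply/funext => x; rewrite diff_lin.
Qed.

Lemma Ck_id k U : Ck k U id.
Proof. by apply: (@Ck_lin V k U idfun) => x; exact: cvg_id. Qed.

Lemma Ck_subset (W : normedModType R) k (U U' : set V) (f : V -> W) :
  U `<=` U' -> Ck k U' f -> Ck k U f.
Proof.
move=> UU'; elim: k f => [|k IH] f /= F; first by move=> x /UU'; exact: F.
by have [d c] := F; split=> [x /UU'|v]; [exact: d|exact: IH].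
Qed.

Lemma Ck_comp_lin (W Z : normedModType R) k U (f : V -> W) (g : {linear W -> Z}) :
  open U -> continuous g -> Ck k U f -> Ck k U (fun x => g (f x)).
Proof.
move=> oU cg; elim: k f => [|k IH] f /=.
  by move=> cf x Ux; apply: continuous_comp; [exact: cf|exact: cg].
move=> [df cf]; split=> [x Ux|v].
  by apply: differentiable_comp; [exact: df|exact: linear_differentiable].
apply: (Ck_eq oU) (IH _ (cf v)) => x Ux /=.
rewrite (diff_comp (df _ Ux)) /=; last exact: linear_differentiable.
by rewrite diff_lin.
Qed.

Lemma Ck_add (W : normedModType R) k U (f g : V -> W) : open U ->
  Ck k U f -> Ck k U g -> Ck k U (fun x => f x + g x).
Proof.
move=> oU; elim: k f g => [|k IH] f g /=.
  by move=> cf cg x Ux; apply: continuousD; [exact: cf|exact: cg].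
move=> [df cf] [dg cg]; split=> [x Ux|v].
  by apply: differentiableD; [exact: df|exact: dg].
apply: (Ck_eq oU) (IH _ _ (cf v) (cg v)) => x Ux.
exact: (esym (congr1 (fun h : V -> _ => h v) (diffD (df _ Ux) (dg _ Ux)))).
Qed.

Lemma Ck_opp (W : normedModType R) k U (f : V -> W) : open U ->
  Ck k U f -> Ck k U (fun x => - f x).
Proof.
move=> oU; elim: k f => [|k IH] f /=.
  by move=> cf x Ux; apply: continuousN; exact: cf.
move=> [df cf]; split=> [x Ux|v]; first by apply: differentiableN; exact: df.
apply: (Ck_eq oU) (IH _ (cf v)) => x Ux.
exact: (esym (congr1 (fun h : V -> _ => h v) (diffN (df _ Ux)))).
Qed.

Lemma Ck_mul k U (f g : V -> R) : open U ->
  Ck k U f -> Ck k U g -> Ck k U (fun x => f x * g x).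
Proof.
move=> oU; elim: k f g => [|k IH] f g /=.
  by move=> cf cg x Ux; apply: continuousM; [exact: cf|exact: cg].
move=> F G; have [df cf] := F; have [dg cg] := G; split=> [x Ux|v].
  by apply: differentiableM; [exact: df|exact: dg].
have H := Ck_add oU (IH _ _ (CkW F) (cg v)) (IH _ _ (CkW G) (cf v)).
apply: (Ck_eq oU) H => x Ux.
exact: (esym (congr1 (fun h : V -> _ => h v) (diffM (df _ Ux) (dg _ Ux)))).
Qed.

(** With a scalar middle variable the differential of the composite at [v] is
    ['d f x v] times the number ['d g (f x) 1], a product of two scalar
    functions of [x]; this keeps the induction on [k] inside [Ck_mul].  A
    vector-valued middle variable would need differentials that depend
    jointly on point and direction. *)
Lemma Ck_comp1 k U (I : set R) (f : V -> R) (g : R -> R) : open U ->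
  (forall x, U x -> I (f x)) ->
  Ck k U f -> Ck k I g -> Ck k U (fun x => g (f x)).
Proof.
move=> oU UI; elim: k f g UI => [|k IH] f g UI.
  by move=> cf cg x Ux; apply: continuous_comp; [exact: cf|exact/cg/UI].
move=> F [dg cg]; have [df cf] := F; split=> [x Ux|v].
  by apply: differentiable_comp; [exact: df|exact/dg/UI].
apply: (Ck_eq oU) (Ck_mul oU (cf v) (IH _ _ UI (CkW F) (cg 1))) => x Ux.
rewrite (diff_comp (df _ Ux)) /=; last exact/dg/UI.
by rewrite -[X in _ = 'd g _ X]mulr1 [RHS]linearZ.
Qed.

Lemma Ck_pair (W Z : normedModType R) k U (f : V -> W) (g : V -> Z) : open U ->
  Ck k U f -> Ck k U g -> Ck k U (fun x => (f x, g x)).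
Proof.
move=> oU; elim: k f g => [|k IH] f g /=.
  by move=> cf cg x Ux; apply: cvg_pair; [exact: cf|exact: cg].
move=> [df cf] [dg cg]; split=> [x Ux|v].
  by apply: differentiable_pair; [exact: df|exact: dg].
apply: (Ck_eq oU) (IH _ _ (cf v) (cg v)) => x Ux.
by rewrite (diff_pair (df _ Ux) (dg _ Ux)).
Qed.

Lemma Ck_sum (W : normedModType R) (I : Type) (s : seq I) k U (f : I -> V -> W) :
  open U -> (forall i, Ck k U (f i)) -> Ck k U (fun x => \sum_(i <- s) f i x).
Proof.
move=> oU cf; elim: s => [|i s IH].
  under [X in Ck _ _ X]eq_fun do rewrite big_nil.
  exact: Ck_cst.
under [X in Ck _ _ X]eq_fun do rewrite big_cons.
exact: Ck_add.
Qed.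

Lemma Ck_scale_cst (W : normedModType R) k U (f : V -> R) (w : W) :
  open U -> Ck k U f -> Ck k U (fun x => f x *: w).
Proof.
move=> oU; elim: k f => [|k IH] f /=.
  by move=> cf x Ux; apply: continuousZr_tmp; exact: cf.
move=> [df cf]; split=> [x Ux|v]; first by apply: differentiableZl; exact: df.
apply: (Ck_eq oU) (IH _ (cf v)) => x Ux.
by rewrite (diffZl _ (df _ Ux)).
Qed.

Lemma Ck_coord n k U (f : V -> 'rV[R]_n) i : open U ->
  Ck k U f -> Ck k U (fun x => f x 0 i).
Proof.
have @g : {linear 'rV[R]_n -> R}.
  by exists (fun N : 'rV[R]_n => N 0 i); do 2![eexists]; do ?[constructor];
     rewrite ?mxE// => ? *; rewrite ?mxE//; move=> ?; rewrite !mxE.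
move=> oU F; apply: (Ck_comp_lin (g := g)) => //; exact: coord_continuous.
Qed.

Lemma Ck_row n k U (f : V -> 'rV[R]_n) : open U ->
  (forall i, Ck k U (fun x => f x 0 i)) -> Ck k U f.
Proof.
move=> oU cf.
rewrite (_ : f = fun x => \sum_i (f x 0 i) *: delta_mx 0 i); last first.
  by apply/funext => x; rewrite -row_sum_delta.
by apply: Ck_sum => // i; apply: Ck_scale_cst.
Qed.

Lemma Ck_fst (W Z : normedModType R) k U (f : V -> W * Z) : open U ->
  Ck k U f -> Ck k U (fun x => (f x).1).
Proof.
move=> oU F; apply: (Ck_comp_lin (g := fst)) => // x; exact: cvg_fst.
Qed.

Lemma Ck_snd (W Z : normedModType R) k U (f : V -> W * Z) : open U ->
  Ck k U f -> Ck k U (fun x => (f x).2).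
Proof.
move=> oU F; apply: (Ck_comp_lin (g := snd)) => // x; exact: cvg_snd.
Qed.

Lemma Ck_scale_rV n k U (f : V -> R) (g : V -> 'rV[R]_n) : open U ->
  Ck k U f -> Ck k U g -> Ck k U (fun x => f x *: g x).
Proof.
move=> oU F G; apply: Ck_row => // i.
under [X in Ck _ _ X]eq_fun do rewrite mxE.
by apply: Ck_mul => //; apply: Ck_coord.
Qed.

End CkGeneral.
End Smooth.

(** * Elementary smooth functions *)

Section SmoothFunctions.
Context {R : realType}.

(** The bootstrap step for functions of one variable: smoothness of solutions
    of differential equations is obtained by feeding the regularity of the
    derivative back into the function. *)
Lemma Ck_derive1 (W : normedModType R) k (I : set R) (f df : R -> W) : open I ->
  (forall t, I t -> is_derive t (1 : R) f (df t)) -> Ck k I df -> Ck k.+1 I f.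
Proof.
move=> oI Df cdf; split=> [t /Df[/derivable1_diffP]//|v].
have C : continuous (GRing.scale v : W -> W).
  by move=> w; apply: continuousZl_tmp; exact: cvg_id.
apply: (Ck_eq oI) (Ck_comp_lin (g := GRing.scale v) oI C cdf) => t It /=.
have [d e] := Df _ It.
by rewrite (deriv1E d) derive1E e.
Qed.

(** Sine and cosine are treated together because each is, up to sign, the
    derivative of the other. *)
Lemma Ck_sin_cos k : Ck k setT (@sin R) /\ Ck k setT (@cos R).
Proof.
elim: k => [|k [IHs IHc]].
  by split=> x _; [exact: continuous_sin|exact: continuous_cos].
split; apply: Ck_derive1 => //; try exact: openT.
exact: (Ck_opp openT).
Qed.

Lemma open_neq0 : open [set x : R | x != 0].
Proof. exact: open_neq. Qed.

Lemma Ck_inv k : Ck k [set x : R | x != 0] GRing.inv.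
Proof.
elim: k => [|k IH]; first by move=> x x0; apply: inv_continuous.
apply: (@Ck_derive1 _ _ _ _ (fun x => - (x^-1 * x^-1))).
- exact: open_neq0.
- move=> t t0; apply: is_derive_eq.
    exact: (@is_deriveV _ id t 1 1 t0).
  by rewrite /GRing.scale /= mulr1 expr2 invfM.
- apply: Ck_opp; first exact: open_neq0.
  by apply: Ck_mul => //; exact: open_neq0.
Qed.

Lemma open_pos : open [set x : R | 0 < x].
Proof. exact: open_gt. Qed.

Lemma Ck_sqrt k : Ck k [set x : R | 0 < x] (Num.sqrt : R -> R).
Proof.
elim: k => [|k IH]; first by move=> x _; exact: sqrt_continuous.
apply: (@Ck_derive1 R _ _ _ (fun x : R => (2 * Num.sqrt x)^-1)); first exact: open_pos.
have H : forall x : R, 0 < x -> 2 * Num.sqrt x != 0.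
  by move=> x x0; rewrite mulf_neq0 // gt_eqF // sqrtr_gt0.
apply: (@Ck_comp1 _ R k _ _ (fun x : R => 2 * Num.sqrt x) _ open_pos H _ (Ck_inv k)).
apply: (@Ck_mul _ R k _ (fun=> 2) _ open_pos) => //; exact: Ck_cst.
Qed.

Context {V : normedModType R} (U : set V) (oU : open U) (k : nat).
Implicit Types f : V -> R.

Lemma Ck_sinf f : Ck k U f -> Ck k U (fun x => sin (f x)).
Proof. by move=> F; apply: (Ck_comp1 (I := setT)) F (Ck_sin_cos k).1. Qed.

Lemma Ck_cosf f : Ck k U f -> Ck k U (fun x => cos (f x)).
Proof. by move=> F; apply: (Ck_comp1 (I := setT)) F (Ck_sin_cos k).2. Qed.

Lemma Ck_invf f : (forall x, U x -> f x != 0) -> Ck k U f ->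
  Ck k U (fun x => (f x)^-1).
Proof. by move=> f0 F; apply: (Ck_comp1 oU f0) F (Ck_inv k). Qed.

Lemma Ck_sqrtf f : (forall x, U x -> 0 < f x) -> Ck k U f ->
  Ck k U (fun x => Num.sqrt (f x)).
Proof. by move=> f0 F; apply: (Ck_comp1 oU f0) F (Ck_sqrt k). Qed.

Lemma Ck_expf f n : Ck k U f -> Ck k U (fun x => f x ^+ n).
Proof.
move=> F; elim: n => [|n IH]; first exact: Ck_cst.
by under [X in Ck _ _ X]eq_fun do rewrite exprS; exact: Ck_mul.
Qed.

Lemma Ck_dot (f g : V -> 'rV[R]_3) : Ck k U f -> Ck k U g ->
  Ck k U (fun x => dot (f x) (g x)).
Proof. by move=> F G; apply: Ck_sum => // i; apply: Ck_mul => //; exact: Ck_coord. Qed.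

Lemma Ck_inner (f g : V -> vec4 R) : Ck k U f -> Ck k U g ->
  Ck k U (fun x => inner (f x) (g x)).
Proof.
move=> F G; apply: Ck_add => //; last by apply: Ck_dot; exact: Ck_snd.
by apply: Ck_mul => //; exact: Ck_fst.
Qed.

Lemma Ck_scale_vec4 f (g : V -> vec4 R) : Ck k U f -> Ck k U g ->
  Ck k U (fun x => f x *: g x).
Proof.
move=> F G; apply: (@Ck_pair _ _ _ _ _ _ (fun x => f x * (g x).1) (fun x => f x *: (g x).2)) => //.
  by apply: Ck_mul => //; exact: Ck_fst.
by apply: Ck_scale_rV => //; exact: Ck_snd.
Qed.

End SmoothFunctions.

Section SmoothClosure.
Context {R : realType}.

Lemma Ck_div (V : normedModType R) (U : set V) k (f g : V -> R) : open U ->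
  (forall x, U x -> g x != 0) -> Ck k U f -> Ck k U g -> Ck k U (fun x => f x / g x).
Proof. by move=> oU h F G; apply: Ck_mul => //; exact: Ck_invf. Qed.

Lemma Ck_sub (V W : normedModType R) (U : set V) k (f g : V -> W) : open U ->
  Ck k U f -> Ck k U g -> Ck k U (fun x => f x - g x).
Proof. by move=> oU F G; apply: Ck_add => //; exact: Ck_opp. Qed.

Lemma Ck_cross (V : normedModType R) (U : set V) k (f g : V -> 'rV[R]_3) : open U ->
  Ck k U f -> Ck k U g -> Ck k U (fun x => cross (f x) (g x)).
Proof.
move=> oU F G; apply: Ck_row => // i.
under [X in Ck _ _ X]eq_fun do rewrite mxE.
by apply: Ck_sub => //; apply: Ck_mul => //; exact: Ck_coord.
Qed.

(** Domains of smoothness are built by successively adding positivity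
    conditions on functions that are continuous where the earlier conditions
    hold. *)
Lemma open_Ck_pos (V : normedModType R) (U : set V) (f : V -> R) : open U ->
  Ck 0 U f -> open (U `&` [set x | 0 < f x]).
Proof.
move=> oU cf; rewrite openE => x [Ux fx]; apply: filterI.
  by apply: open_nbhs_nbhs; split.
exact: cvgr_gt (cf x Ux) _ fx.
Qed.

End SmoothClosure.

(** * Derivatives of curves *)

Section Derivatives.
Context {R : realType}.

Lemma is_derive_ext (V W : normedModType R) (f g : V -> W) x v d :
  f =1 g -> is_derive x v f d -> is_derive x v g d.
Proof. by move=> /funext ->. Qed.

Lemma is_derive_lin (V W : normedModType R) (f : R -> V) (g : {linear V -> W}) t df :
  continuous g -> is_derive t (1 : R) f df ->
  is_derive t (1 : R) (fun s => g (f s)) (g df).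
Proof.
move=> cg [/derivable1_diffP D <-].
have dg : differentiable g (f t) by exact: linear_differentiable.
have H : differentiable (g \o f) t by exact: differentiable_comp.
split; first exact/derivable1_diffP.
rewrite deriveE // (diff_comp D dg) /= diff_lin //.
by rewrite deriveE.
Qed.

Lemma is_derive_pair (V W : normedModType R) (f : R -> V) (g : R -> W) t df dg :
  is_derive t (1 : R) f df -> is_derive t (1 : R) g dg ->
  is_derive t (1 : R) (fun s => (f s, g s)) (df, dg).
Proof.
move=> [/derivable1_diffP D <-] [/derivable1_diffP D' <-].
have H := differentiable_pair D D'.
split; first exact/derivable1_diffP.
by rewrite deriveE // (diff_pair D D') -!deriveE.
Qed.

Lemma is_derive_fst (V W : normedModType R) (f : R -> V * W) t df :
  is_derive t (1 : R) f df -> is_derive t (1 : R) (fun s => (f s).1) df.1.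
Proof. by apply: (is_derive_lin (g := fst)) => x; exact: cvg_fst. Qed.

Lemma is_derive_snd (V W : normedModType R) (f : R -> V * W) t df :
  is_derive t (1 : R) f df -> is_derive t (1 : R) (fun s => (f s).2) df.2.
Proof. by apply: (is_derive_lin (g := snd)) => x; exact: cvg_snd. Qed.

Lemma is_derive_rowP n (f : R -> 'rV[R]_n) t df :
  is_derive t (1 : R) f df <->
  forall i, is_derive t (1 : R) (fun s => f s 0 i) (df 0 i).
Proof.
split=> [[D <-] i|D].
  split; first by have /derivable_mxP := D; apply.
  by rewrite derive_mx // mxE.
have d : derivable f t 1 by apply/derivable_mxP => i j; rewrite ord1; case: (D j).
split=> //; rewrite derive_mx //; apply/rowP => i; rewrite mxE.
by case: (D i).
Qed.

Lemma is_derive_mul (f g : R -> R) t df dg :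
  is_derive t (1 : R) f df -> is_derive t (1 : R) g dg ->
  is_derive t (1 : R) (fun s => f s * g s) (f t * dg + df * g t).
Proof.
move=> F G; have := is_deriveM F G.
by rewrite /GRing.scale /= [g t * df]mulrC.
Qed.

Lemma is_derive_scale_rV n (f : R -> R) (g : R -> 'rV[R]_n) t df dg :
  is_derive t (1 : R) f df -> is_derive t (1 : R) g dg ->
  is_derive t (1 : R) (fun s => f s *: g s) (f t *: dg + df *: g t).
Proof.
move=> F /is_derive_rowP G; apply/is_derive_rowP => i.
apply: is_derive_eq.
  by apply: (is_derive_ext _ (is_derive_mul F (G i))) => s; rewrite mxE.
by rewrite !mxE.
Qed.

Lemma is_derive_scale_vec4 (f : R -> R) (g : R -> vec4 R) t df dg :
  is_derive t (1 : R) f df -> is_derive t (1 : R) g dg ->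
  is_derive t (1 : R) (fun s => f s *: g s) (f t *: dg + df *: g t).
Proof.
move=> F G.
have H1 := is_deriveM F (is_derive_fst G).
have H2 := is_derive_scale_rV F (is_derive_snd G).
have := is_derive_pair H1 H2.
by rewrite [in X in is_derive _ _ _ X -> _]/GRing.scale /= [(g t).1 * df]mulrC.
Qed.

Lemma is_derive_dot (f g : R -> 'rV[R]_3) t df dg :
  is_derive t (1 : R) f df -> is_derive t (1 : R) g dg ->
  is_derive t (1 : R) (fun s => dot (f s) (g s)) (dot (f t) dg + dot df (g t)).
Proof.
move=> /is_derive_rowP F /is_derive_rowP G.
have H := is_derive_sum (fun i => is_derive_mul (F i) (G i)).
rewrite /dot -big_split /=; apply: is_derive_ext H => s.
by rewrite fct_sumE.
Qed.

Lemma is_derive_inner (f g : R -> vec4 R) t df dg :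
  is_derive t (1 : R) f df -> is_derive t (1 : R) g dg ->
  is_derive t (1 : R) (fun s => inner (f s) (g s)) (inner (f t) dg + inner df (g t)).
Proof.
move=> F G.
have H := is_deriveD (is_derive_mul (is_derive_fst F) (is_derive_fst G))
  (is_derive_dot (is_derive_snd F) (is_derive_snd G)).
apply: (is_derive_eq (is_derive_ext _ H)) => //.
by rewrite /inner; ring.
Qed.

Lemma is_derive_comp (W : normedModType R) (f : R -> W) (g : R -> R) t df dg :
  is_derive (g t) (1 : R) f df -> is_derive t (1 : R) g dg ->
  is_derive t (1 : R) (fun s => f (g s)) (dg *: df).
Proof.
move=> [/[dup] d /derivable1_diffP D <-] [/derivable1_diffP D' <-].
have H : differentiable (f \o g) t by exact: differentiable_comp.
split; first exact/derivable1_diffP.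
rewrite deriveE // (diff_comp D' D) /= (deriv1E d) derive1E.
by rewrite -deriveE.
Qed.

Lemma is_derive_cont (W : normedModType R) (f : R -> W) t df :
  is_derive t (1 : R) f df -> {for t, continuous f}.
Proof. by case=> /derivable1_diffP D _; exact: differentiable_continuous. Qed.

Lemma is_derive_near (W : normedModType R) (J : set R) (f g : R -> W) t df :
  open J -> J t -> (forall s, J s -> f s = g s) ->
  is_derive t (1 : R) f df -> is_derive t (1 : R) g df.
Proof.
move=> oJ Jt fg; apply: near_eq_is_derive.
have : \forall s \near t, J s by apply: open_nbhs_nbhs; split.
by apply: filterS => s /fg.
Qed.

End Derivatives.

(** * Functions on an open interval *)

Section Intervals.
Context {R : realType} (J : set R) (oJ : open J) (iJ : is_interval J).
Implicit Types (f df : R -> R) (a b t : R).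

Lemma interval_open_near t : J t -> \forall s \near t, J s.
Proof. by move=> Jt; apply: open_nbhs_nbhs; split. Qed.

Lemma interval_open_wider t : J t -> exists a b, [/\ J a, J b, a < t & t < b].
Proof.
move=> Jt; have /nbhs_ballP[e /= e0 H] := interval_open_near Jt.
exists (t - e / 2), (t + e / 2).
have e2 : `|e / 2| < e by rewrite gtr0_norm ?divr_gt0 // ltr_pdivrMr // ltr_pMr // ltr1n.
split.
- by apply: H; rewrite /ball /= opprB addrC subrK.
- by apply: H; rewrite /ball /= opprD addrA subrr sub0r normrN.
- by rewrite ltrBlDr ltrDl divr_gt0.
- by rewrite ltrDl divr_gt0.
Qed.

Lemma interval_within f a b : J a -> J b ->
  (forall t, J t -> {for t, continuous f}) -> {within `[a, b], continuous f}.
Proof.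
move=> Ja Jb cf; apply: continuous_in_subspaceT => t; rewrite inE /= in_itv /= => tab.
by apply: cf; exact: iJ Ja Jb _ tab.
Qed.

Lemma interval_MVT f df a b : (forall t, J t -> is_derive t (1 : R) f (df t)) ->
  J a -> J b -> a < b ->
  exists2 c, J c & f b - f a = df c * (b - a).
Proof.
move=> D Ja Jb ab.
have Jab t : t \in `]a, b[ -> J t.
  by rewrite in_itv /= => /andP[x y]; apply: iJ Ja Jb _ _; rewrite !ltW.
have [c cab ->] := MVT ab (fun t h => D t (Jab t h))
  (interval_within Ja Jb (fun t h => is_derive_cont (D t h))).
by exists c => //; exact: Jab.
Qed.

Lemma interval_cst f a b : (forall t, J t -> is_derive t (1 : R) f 0) ->
  J a -> J b -> f a = f b.
Proof.
move=> D Ja Jb; have [ab|ba|->//] := ltgtP a b.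
  by have [c _ /eqP] := interval_MVT D Ja Jb ab; rewrite mul0r subr_eq0 => /eqP.
by have [c _ /eqP] := interval_MVT D Jb Ja ba; rewrite mul0r subr_eq0 => /eqP.
Qed.

Lemma interval_cst_vec4 (f : R -> vec4 R) a b :
  (forall t, J t -> is_derive t (1 : R) f 0) -> J a -> J b -> f a = f b.
Proof.
move=> D Ja Jb; apply: injective_projections.
  by apply: (interval_cst (f := fun s => (f s).1)) => // t /D /is_derive_fst.
apply/rowP => i; apply: (interval_cst (f := fun s => (f s).2 0 i)) => // t.
by move=> /D /is_derive_snd /is_derive_rowP /(_ i); rewrite mxE.
Qed.

Lemma interval_incr f df a b : (forall t, J t -> is_derive t (1 : R) f (df t)) ->
  (forall t, J t -> 0 < df t) -> J a -> J b -> a < b -> f a < f b.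
Proof.
move=> D p Ja Jb ab; have [c Jc E] := interval_MVT D Ja Jb ab.
by rewrite -subr_gt0 E mulr_gt0 ?p // subr_gt0.
Qed.

Lemma interval_IVT f a b v : (forall t, J t -> {for t, continuous f}) ->
  J a -> J b -> Num.min (f a) (f b) <= v <= Num.max (f a) (f b) ->
  exists2 c, Num.min a b <= c <= Num.max a b & f c = v.
Proof.
move=> cf; wlog ab : a b / a <= b.
  move=> H Ja Jb v1; have [ab|/ltW ba] := leP a b.
    by have := H _ _ ab Ja Jb v1; rewrite min_l // max_r.
  have := H _ _ ba Jb Ja; rewrite minC maxC => /(_ v1).
  by rewrite min_l // max_r.
move=> Ja Jb v1; have [c cab fc] := IVT ab (interval_within Ja Jb cf) v1.
by exists c => //; rewrite min_l // max_r.
Qed.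

(** The intermediate value theorem makes the image an interval, and strict
    monotonicity around an interior point makes it open. *)
Lemma interval_image f df : (forall t, J t -> is_derive t (1 : R) f (df t)) ->
  (forall t, J t -> 0 < df t) -> open (f @` J) /\ is_interval (f @` J).
Proof.
move=> D p; have I x y : J x -> J y -> forall z, f x <= z <= f y -> (f @` J) z.
  move=> Jx Jy z /andP[xz zy].
  have [|c] := @interval_IVT f x y z (fun t h => is_derive_cont (D t h)) Jx Jy.
    by rewrite ge_min xz le_max zy orbT.
  move=> /andP[c1 c2] <-; exists c => //.
  apply: (iJ (x := Num.min x y) (y := Num.max x y)); last by rewrite c1.
    by case: leP.
  by case: leP.
split; last by move=> _ _ [x Jx <-] [y Jy <-]; exact: I.
rewrite openE => _ [x Jx <-].
have [a [b [Ja Jb ax xb]]] := interval_open_wider Jx.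
have fax := interval_incr D p Ja Jx ax.
have fxb := interval_incr D p Jx Jb xb.
have : \forall z \near f x, f a < z < f b.
  by apply: near_in_itvoo; rewrite in_itv /= fax.
by apply: filterS => z /andP[az zb]; apply: I Ja Jb _ _; rewrite !ltW.
Qed.

Lemma oriented_integralxx f a : oriented_integral a a f = 0.
Proof. by rewrite /oriented_integral lexx set_itv1 Rintegral_set1. Qed.

(** Choosing a point [c] of [J] below both [a] and [t] writes the oriented
    integral near [t], on either side of [a], as a difference of two integrals
    from [c], only one of which varies. *)
Lemma is_derive_oriented_integral f a t :
  (forall s, J s -> {for s, continuous f}) -> J a -> J t ->
  is_derive t (1 : R) (fun s => oriented_integral a s f) (f t).
Proof.
move=> cf Ja Jt.
have [c [Jc ca]] : exists c, J c /\ c < Num.min a t.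
  have Jm : J (Num.min a t) by case: leP.
  by have [c [_ [Jc _ h _]]] := interval_open_wider Jm; exists c.
have [u [Ju au]] : exists u, J u /\ Num.max a t < u.
  have Jm : J (Num.max a t) by case: leP.
  by have [_ [u [_ Ju _ h]]] := interval_open_wider Jm; exists u.
move: ca au; rewrite lt_min gt_max => /andP[ca ct] /andP[au tu].
have intf : (@lebesgue_measure R).-integrable `[c, u] (EFin \o f).
  apply: continuous_compact_integrable; first exact: segment_compact.
  exact: interval_within.
pose F y := \int[@lebesgue_measure R]_(s in `[c, y]) f s.
have [dF eF] := continuous_FTC1_closed tu intf ct (cf _ Jt).
have DF : is_derive t (1 : R) F (f t) by apply: DeriveDef; [exact: dF|rewrite -derive1E; exact: eF].
have itS x y : c <= x -> y <= u ->
    (@lebesgue_measure R).-integrable `[x, y] (EFin \o f).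
  move=> cx yu; apply: integrableS intf => //.
  by apply: subset_itv; rewrite bnd_simp.
have FB x y : c < x -> x <= y -> y <= u ->
    F y - F x = \int[@lebesgue_measure R]_(s in `[x, y]) f s.
  move=> cx xy yu; rewrite /F Rintegral_itvB; last 3 first.
  - exact: itS.
  - by rewrite bnd_simp ltW.
  - by rewrite bnd_simp.
  rewrite Rintegral_itv_obnd_cbnd //.
  apply: integrableS (itS x y (ltW cx) yu) => //.
  by apply: subset_itv; rewrite bnd_simp.
have E : is_derive t (1 : R) (fun s => F s - F a) (f t).
  by have := is_deriveB DF (is_derive_cst (F a) t 1); rewrite subr0.
apply: (@is_derive_near _ _ `]c, u[%classic) E.
- exact: itv_open.
- by rewrite /= in_itv /= ct.
- move=> s; rewrite /= in_itv /= => /andP[cs su].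
  rewrite /oriented_integral; case: leP => as_.
    by rewrite FB // ltW.
  by rewrite -FB ?ltW // opprB.
Qed.

End Intervals.

(** * Kepler's equation *)

Section KeplerEquation.
Context {R : realType}.
Implicit Types a b : R.

Lemma sin_sqr_lt (x : R) : x != 0 -> sin x ^+ 2 < x ^+ 2.
Proof.
have main (y : R) : 0 < y -> sin y ^+ 2 < y ^+ 2.
  move=> y0; have [y1|y1] := leP y 1; last first.
    have := cos2Dsin2 y; have := sqr_ge0 (cos y); nra.
  have pi2 := pi_ge2 R.
  have s0 : 0 < sin y by apply: sin_gt0_pi; lra.
  have [c] := MVT y0 (fun t _ => is_derive_sin t)
    (continuous_subspaceT (@continuous_sin R)).
  rewrite in_itv /= sin0 !subr0 => /andP[c0 cy] E.
  have c1 : cos c < 1.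
    by rewrite -cos0 ltr_cos // in_itv /=; lra.
  have : sin y < y by rewrite E; nra.
  by move=> ?; nra.
move=> x0; have [x1|x1|x1] := ltgtP x 0; last by rewrite x1 eqxx in x0.
  by rewrite -[x]opprK sinN !sqrrN -[ltRHS]sqrrN; apply: main; rewrite oppr_gt0.
exact: main.
Qed.

(** The chord of the unit circle is strictly shorter than the arc: its square
    is four times the squared sine of half the arc. *)
Lemma chord_sqr_lt (x y : R) : x != y ->
  (sin y - sin x) ^+ 2 + (cos y - cos x) ^+ 2 < (y - x) ^+ 2.
Proof.
move=> xy; set h := (y - x) / 2.
have h0 : h != 0 by rewrite mulf_neq0 ?invr_eq0 // subr_eq0 eq_sym.
have E : (sin y - sin x) ^+ 2 + (cos y - cos x) ^+ 2 = 4 * sin h ^+ 2.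
  have hyx : y - x = h *+ 2 by rewrite -mulr_natr mulfVK.
  have := cosB y x; rewrite hyx cos_mulr2n => cB.
  have c1 := cos2Dsin2 x; have c2 := cos2Dsin2 y; have c3 := cos2Dsin2 h.
  rewrite -mulr_natr in cB.
  have : (sin y - sin x) ^+ 2 + (cos y - cos x) ^+ 2 =
     (cos y ^+ 2 + sin y ^+ 2) + (cos x ^+ 2 + sin x ^+ 2)
     - 2 * (cos y * cos x + sin y * sin x) by ring.
  by rewrite c1 c2 -cB => ->; lra.
have -> : (y - x) ^+ 2 = 4 * h ^+ 2 by rewrite /h; field.
by rewrite E ltr_pM2l // sin_sqr_lt.
Qed.

(** Kepler's equation is [kepler_eq a b y = 0].  For [(a, b) = (e, 0)] it is
    the classical equation between mean and eccentric anomaly with mean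
    anomaly zero; in general the phase is absorbed in the vector [(a, b)],
    whose norm is the eccentricity. *)
Definition kepler_eq a b (y : R) := y - (a * sin y - b * cos y).

(** By Cauchy-Schwarz the increment of [a sin y - b cos y] is at most the
    chord, hence smaller than the increment of [y].  The bound includes
    eccentricity one, that is, collision orbits. *)
Lemma kepler_eq_incr a b x y : a ^+ 2 + b ^+ 2 <= 1 -> x < y ->
  kepler_eq a b x < kepler_eq a b y.
Proof.
move=> ab xy; have /chord_sqr_lt : x != y by rewrite lt_eqF.
rewrite /kepler_eq; set u := sin y - _; set w := cos y - _ => uw.
have cs : (a * u - b * w) ^+ 2 <= u ^+ 2 + w ^+ 2.
  have : (a * u - b * w) ^+ 2 + (a * w + b * u) ^+ 2 =
     (a ^+ 2 + b ^+ 2) * (u ^+ 2 + w ^+ 2) by ring.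
  have := sqr_ge0 (a * w + b * u); have := sqr_ge0 u; have := sqr_ge0 w; nra.
have h2 : (a * u - b * w) ^+ 2 < (y - x) ^+ 2 by exact: le_lt_trans uw.
have : a * u - b * w < y - x.
  have yx : 0 < y - x by rewrite subr_gt0.
  rewrite ltNge; apply/negP => h; nra.
by rewrite /u /w; lra.
Qed.

Lemma kepler_eq_inj a b x y : a ^+ 2 + b ^+ 2 <= 1 ->
  kepler_eq a b x = kepler_eq a b y -> x = y.
Proof.
move=> ab E; have [xy|xy|//] := ltgtP x y.
  by have := kepler_eq_incr ab xy; rewrite E ltxx.
by have := kepler_eq_incr ab xy; rewrite E ltxx.
Qed.

Lemma continuous_kepler_eq a b : continuous (kepler_eq a b).
Proof.
move=> x; apply: (@is_derive_cont R R _ x (1 - (a * cos x - b * - sin x))).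
Qed.

Lemma kepler_eq_ex a b : a ^+ 2 + b ^+ 2 <= 1 -> exists y, kepler_eq a b y = 0.
Proof.
move=> ab; have bd y : (a * sin y - b * cos y) ^+ 2 <= 1.
  have : (a * sin y - b * cos y) ^+ 2 + (a * cos y + b * sin y) ^+ 2 =
     (a ^+ 2 + b ^+ 2) * (cos y ^+ 2 + sin y ^+ 2) by ring.
  rewrite cos2Dsin2; have := sqr_ge0 (a * cos y + b * sin y); nra.
have [|||y _ E] := @IVT R (kepler_eq a b) (-1) 1 0; last by exists y.
- lra.
- exact/continuous_subspaceT/continuous_kepler_eq.
- rewrite ge_min le_max /kepler_eq; apply/andP; split; apply/orP; [left|right].
    have := bd (-1); nra.
  have := bd 1; nra.
Qed.

Definition kepler_sol a b := xget 0 [set y | kepler_eq a b y = 0].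

Lemma kepler_solP a b : a ^+ 2 + b ^+ 2 <= 1 ->
  kepler_sol a b = a * sin (kepler_sol a b) - b * cos (kepler_sol a b).
Proof.
move=> /kepler_eq_ex [y Ey]; apply/eqP; rewrite -subr_eq0; apply/eqP.
exact: (@xgetPex _ 0 [set y | kepler_eq a b y = 0]) (ex_intro _ y Ey).
Qed.

Lemma kepler_sol_uniq a b y : a ^+ 2 + b ^+ 2 <= 1 ->
  y = a * sin y - b * cos y -> y = kepler_sol a b.
Proof.
move=> ab E; apply: (kepler_eq_inj ab).
by rewrite /kepler_eq {1}E -kepler_solP // !subrr.
Qed.

(** If the derivative of Kepler's equation vanished at its solution [y], then
    [y ^+ 2 + (a * cos y + b * sin y) ^+ 2 <= 1] would force [y = 0] and
    [a = 1]: the equation degenerates only at the pole, where the Kepler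
    problem has a collision. *)
Lemma kepler_sol_nondeg a b (y := kepler_sol a b) :
  a ^+ 2 + b ^+ 2 <= 1 -> a != 1 -> 0 < 1 - (a * cos y + b * sin y).
Proof.
move=> ab a1; have E := kepler_solP ab; rewrite -/y in E.
rewrite ltNge; apply/negP => H.
have S : y ^+ 2 + (a * cos y + b * sin y) ^+ 2 <= 1.
  rewrite {1}E (_ : _ + _ = (a ^+ 2 + b ^+ 2) * (cos y ^+ 2 + sin y ^+ 2)).
    by rewrite cos2Dsin2 mulr1.
  by ring.
have /eqP : y ^+ 2 = 0 by apply/eqP; rewrite eq_le sqr_ge0 andbT; nra.
rewrite sqrf_eq0 => /eqP y0; move: H S; rewrite y0 cos0 sin0 !mulr0 mulr1 addr0.
move=> h1 h2; have : a = 1 by nra.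
by move/eqP; rewrite (negbTE a1).
Qed.

Section SmoothSolution.
Context {V : normedModType R}.

(** A product is differentiable where one factor is differentiable and
    vanishes and the other is merely continuous: the increment of the second
    factor multiplies a quantity of first order. *)
Lemma diff_mul_vanish (N H : V -> R) x0 : differentiable N x0 -> N x0 = 0 ->
  {for x0, continuous H} ->
  differentiable (fun x => N x * H x) x0 /\
  forall v, 'd (fun x => N x * H x) x0 v = H x0 * 'd N x0 v.
Proof.
move=> dN N0 cH.
(* The part of the product that is of second order at x0. *)
have small : (fun x => N x * (H x - H x0)) \o shift x0 =
    cst (N x0 * (H x0 - H x0)) + (0 : V -> R) +o_ 0 id.
  apply/eqaddoP => e e0 /=.
  have [k k0 dk] := linear_lipschitz (diff_continuous dN).
  have := diff_locally dN => /eqaddoP /(_ 1 ltr01) oN.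
  have ek : 0 < e / (k + 1) by rewrite divr_gt0 // addr_gt0.
  have oH : \forall h \near (0 : V), `|H x0 - H (h + x0)| < e / (k + 1).
    have : \forall x \near x0, `|H x0 - H x| < e / (k + 1).
      by move/cvgrPdist_lt : cH => /(_ _ ek).
    by rewrite (near_shift 0) subr0.
  near=> h.
  have A : `|N (h + x0)| <= (k + 1) * `|h|.
    have -> : N (h + x0) = (N (h + x0) - 'd N x0 h) + 'd N x0 h by rewrite subrK.
    apply: le_trans (ler_normD _ _) _; rewrite mulrDl mul1r [leRHS]addrC.
    apply: lerD; last exact: dk.
    have : `|(N \o shift x0 - (cst (N x0) + 'd N x0)) h| <= 1 * `|h|.
      by near: h; exact: oN.
    by rewrite /= !fctE /= N0 add0r mul1r.
  have B : `|H x0 - H (h + x0)| < e / (k + 1) by near: h.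
  rewrite /= !fctE /= N0 mul0r addr0 subr0 normrM.
  have -> : e * `|h| = ((k + 1) * `|h|) * (e / (k + 1)).
    by field; rewrite gt_eqF // addr_gt0.
  by apply: ler_pM => //; rewrite distrC ltW.
have z0 : continuous (\0 : V -> R) by move=> x; exact: cst_continuous.
have d0 : 'd (fun x => N x * (H x - H x0)) x0 = \0 :> (V -> R).
  by apply: (diff_unique z0); exact: small.
have D0 : differentiable (fun x => N x * (H x - H x0)) x0.
  apply/diff_locallyP; rewrite d0; split; first exact: z0.
  exact: small.
have E : (fun x => N x * H x) = (H x0 *: N) + (fun x => N x * (H x - H x0)).
  by apply/funext => x; rewrite !fctE /GRing.scale /=; ring.
have dZ := is_diffZ (H x0) (differentiableP dN).
have D : is_diff x0 (fun x => N x * H x) (H x0 *: ('d N x0 : V -> R) + \0).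
  by rewrite E; apply: (is_diffD dZ); exact: DiffDef D0 d0.
split=> [|v]; first by case: D.
case: D => _ /(congr1 (fun h : V -> R => h v)) e; apply: (etrans e).
by rewrite !fctE addr0.
Unshelve. all: by end_near.
Qed.

Context (U : set V) (oU : open U) (A B : V -> R).
Hypothesis A_smooth : forall k, Ck k U A.
Hypothesis B_smooth : forall k, Ck k U B.
Hypothesis AB_le1 : forall x, U x -> A x ^+ 2 + B x ^+ 2 <= 1.
Hypothesis A_neq1 : forall x, U x -> A x != 1.

Let f (x : V) : R := kepler_sol (A x) (B x).

(** Kepler's equation has opposite strict signs at the two ends of a small
    interval around the solution; both signs persist for nearby parameters,
    and monotonicity traps the solution. *)
Lemma continuous_kepler_sol x0 : U x0 -> {for x0, continuous f}.
Proof.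
move=> Ux0; apply/cvgrPdist_lt => e e0.
have E0 : kepler_eq (A x0) (B x0) (f x0) = 0.
  by rewrite /kepler_eq {1}/f kepler_solP ?subrr // AB_le1.
have c y : kepler_eq (A x) (B x) y @[x --> x0] --> kepler_eq (A x0) (B x0) y.
  apply: cvgB; first exact: cvg_cst.
  by apply: cvgB; apply: cvgM; try exact: cvg_cst; [exact: (A_smooth 0)|exact: (B_smooth 0)].
have n : \forall x \near x0, U x by apply: open_nbhs_nbhs; split.
have l1 : kepler_eq (A x0) (B x0) (f x0 - e) < 0.
  by rewrite -E0 kepler_eq_incr ?AB_le1 // ltrBlDr ltrDl.
have l2 : 0 < kepler_eq (A x0) (B x0) (f x0 + e).
  by rewrite -E0 kepler_eq_incr ?AB_le1 // ltrDl.
near=> x.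
have Ux : U x by near: x.
(* Strict signs at f x0 - e and f x0 + e survive a small change of x. *)
have m1 : kepler_eq (A x) (B x) (f x0 - e) < 0.
  by near: x; apply: cvgr_lt (c _) _ l1.
have m2 : 0 < kepler_eq (A x) (B x) (f x0 + e).
  by near: x; apply: cvgr_gt (c _) _ l2.
have Ex : kepler_eq (A x) (B x) (f x) = 0.
  by rewrite /kepler_eq {1}/f kepler_solP ?subrr // AB_le1.
have mono y z : kepler_eq (A x) (B x) y < kepler_eq (A x) (B x) z -> y < z.
  move=> h; rewrite ltNge le_eqVlt; apply/negP => /predU1P[zy|zy].
    by rewrite zy ltxx in h.
  by have := lt_trans h (kepler_eq_incr (AB_le1 Ux) zy); rewrite ltxx.
have h1 : f x0 - e < f x by apply: mono; rewrite Ex.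
have h2 : f x < f x0 + e by apply: mono; rewrite Ex.
by rewrite ltr_norml; apply/andP; split; lra.
Unshelve. all: by end_near.
Qed.

Let den (x : V) : R := 1 - (A x * cos (f x) + B x * sin (f x)).

(** An implicit function theorem by hand.  With Caratheodory slopes [S] and
    [C] of sine and cosine at [p = f x0], Kepler's equation reads
    [G x * (f x - p) = N x], where [N] is explicit and vanishes at [x0] and
    [G] is continuous and nonzero there.  So [f = p + N / G] near [x0], and
    [diff_mul_vanish] applies. *)
Lemma diff_kepler_sol x0 : U x0 -> differentiable f x0 /\
  forall v, 'd f x0 v =
    (den x0)^-1 * (sin (f x0) * 'd A x0 v - cos (f x0) * 'd B x0 v).
Proof.
move=> Ux0; pose p : R := f x0.
have [S [SE cS S0]] := (is_derive1_caratheodory _ _ _).1 (is_derive_sin p).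
have [C [CE cC C0]] := (is_derive1_caratheodory _ _ _).1 (is_derive_cos p).
have cf := continuous_kepler_sol Ux0.
pose G (x : V) : R := 1 - (A x * S (f x) - B x * C (f x)).
have cA : {for x0, continuous A} by exact: (A_smooth 0).
have cB : {for x0, continuous B} by exact: (B_smooth 0).
have cG : {for x0, continuous G}.
  apply: cvgB; first exact: cvg_cst.
  apply: cvgB; apply: cvgM => //.
    exact: (continuous_comp cf cS).
  exact: (continuous_comp cf cC).
have G0 : G x0 = den x0 by rewrite /G -/p S0 C0 /den -/p; ring.
have G0n : G x0 != 0.
  by rewrite G0 gt_eqF //; apply: kepler_sol_nondeg; [exact: AB_le1|exact: A_neq1].
pose N (x : V) : R := - kepler_eq (A x) (B x) p.
have dA := (A_smooth 1).1 _ Ux0; have dB := (B_smooth 1).1 _ Ux0.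
have NE : N = (sin p *: A) - (cos p *: B) - cst p.
  by apply/funext => x; rewrite /N /kepler_eq !fctE /GRing.scale /=; ring.
have dNv := is_diffB (is_diffB (is_diffZ (sin p) (differentiableP dA))
  (is_diffZ (cos p) (differentiableP dB))) (is_diff_cst p x0).
rewrite -NE in dNv.
have dN : differentiable N x0 by case: dNv.
have dNE v : 'd N x0 v = sin p * 'd A x0 v - cos p * 'd B x0 v.
  case: dNv => _ /(congr1 (fun h : V -> R => h v)) e; apply: (etrans e).
  by rewrite !fctE subr0.
have N0 : N x0 = 0.
  by rewrite /N /kepler_eq {1}/p {1}/f kepler_solP ?AB_le1 // subrr oppr0.
have cH : {for x0, continuous (fun x => (G x)^-1)} by apply: cvgV.
have [dNH dNHE] := diff_mul_vanish dN N0 cH.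
have dF := is_diffD (is_diff_cst p x0) (differentiableP dNH).
have near_f : \forall x \near x0, (cst p + (fun x => N x * (G x)^-1)) x = f x.
  have n : \forall x \near x0, U x by apply: open_nbhs_nbhs; split.
  near=> x; have Ux : U x by near: x.
  have Gx : G x != 0 by near: x; exact: cvgr_neq0 cG G0n.
  have Ex : kepler_eq (A x) (B x) (f x) = 0.
    by rewrite /kepler_eq {1}/f kepler_solP ?subrr // AB_le1.
  have : N x = G x * (f x - p).
    rewrite /N /G -[LHS]add0r -Ex /kepler_eq.
    have := SE (f x); have := CE (f x); move=> e1 e2.
    have -> : sin (f x) = sin p + S (f x) * (f x - p) by rewrite -e2; ring.
    have -> : cos (f x) = cos p + C (f x) * (f x - p) by rewrite -e1; ring.
    by ring.
  by rewrite !fctE /= => ->; field.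
have [df dfE] := near_eq_diff near_f (ex_diff (is_diff_def := dF)); split=> // v.
rewrite dfE; case: dF => _ /(congr1 (fun h : V -> R => h v)) e; apply: (etrans e).
by rewrite !fctE add0r dNHE G0 dNE.
Unshelve. all: by end_near.
Qed.

(** The differential found in [diff_kepler_sol] is a smooth expression in
    [A], [B], their differentials and the solution itself, so each order of
    regularity gives the next. *)
Lemma Ck_kepler_sol k : Ck k U f.
Proof.
elim: k => [|k IH]; first by move=> x; exact: continuous_kepler_sol.
split=> [x Ux|v]; first by have [] := diff_kepler_sol Ux.
have cs := Ck_sinf oU IH; have cc := Ck_cosf oU IH.
have dAv := (A_smooth k.+1).2 v; have dBv := (B_smooth k.+1).2 v.
have H : Ck k U (fun x => (den x)^-1 * (sin (f x) * 'd A x v - cos (f x) * 'd B x v)).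
  apply: Ck_mul => //.
    apply: Ck_invf => //.
      move=> x Ux; rewrite gt_eqF //.
      by apply: kepler_sol_nondeg; [exact: AB_le1|exact: A_neq1].
    apply: (Ck_add oU (Ck_cst _ _ _)); apply: (Ck_opp oU).
    by apply: (Ck_add oU); apply: (Ck_mul oU).
  apply: (Ck_add oU); first exact: (Ck_mul oU).
  by apply: (Ck_opp oU); apply: (Ck_mul oU).
apply: (Ck_eq oU) H => x Ux.
by have [_ ->] := diff_kepler_sol Ux.
Qed.

End SmoothSolution.
End KeplerEquation.

(** * Orthonormal pairs and Kepler data *)

Section Geometry.
Context {R : realType}.
Implicit Types (u w x p : 'rV[R]_3) (X Y Z : vec4 R).

Lemma dotDL u w x : dot (u + w) x = dot u x + dot w x.
Proof. by rewrite -[u in LHS]scale1r dotDl mul1r. Qed.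

Lemma dotZL (a : R) u x : dot (a *: u) x = a * dot u x.
Proof.
rewrite -[a *: u]addr0 dotDl (_ : dot 0 x = 0) ?addr0 //.
by rewrite /dot big1 // => i _; rewrite mxE mul0r.
Qed.

Lemma dotNL u x : dot (- u) x = - dot u x.
Proof. by rewrite -scaleN1r dotZL mulN1r. Qed.

Lemma dotDR x u w : dot x (u + w) = dot x u + dot x w.
Proof. by rewrite !(dotC x) dotDL. Qed.

Lemma dotZR (a : R) x u : dot x (a *: u) = a * dot x u.
Proof. by rewrite !(dotC x) dotZL. Qed.

Lemma dotNR x u : dot x (- u) = - dot x u.
Proof. by rewrite !(dotC x) dotNL. Qed.

Definition dotE := (dotDL, dotDR, dotZL, dotZR, dotNL, dotNR).

Lemma dot_ge0 u : 0 <= dot u u.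
Proof. by apply: sumr_ge0 => i _; rewrite -expr2 sqr_ge0. Qed.

Lemma innerDL X Y Z : inner (X + Y) Z = inner X Z + inner Y Z.
Proof. by rewrite -[X in LHS]scale1r innerDl mul1r. Qed.

Lemma innerNL X Z : inner (- X) Z = - inner X Z.
Proof. by rewrite -scaleN1r innerZl mulN1r. Qed.

Lemma innerDR X Y Z : inner X (Y + Z) = inner X Y + inner X Z.
Proof. by rewrite !(innerC X) innerDL. Qed.

Lemma innerZR (a : R) X Y : inner X (a *: Y) = a * inner X Y.
Proof. by rewrite !(innerC X) innerZl. Qed.

Lemma innerNR X Y : inner X (- Y) = - inner X Y.
Proof. by rewrite !(innerC X) innerNL. Qed.

Definition innerE := (innerDL, innerDR, innerZl, innerZR, innerNL, innerNR).

Lemma inner_e0 X : inner (e0 R) X = X.1.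
Proof.
rewrite /inner /= mul1r -[RHS]addr0; congr (_ + _).
by rewrite /dot big1 // => i _; rewrite mxE mul0r.
Qed.

Lemma inner_ge0 X : 0 <= inner X X.
Proof. by rewrite /inner addr_ge0 ?dot_ge0 // -expr2 sqr_ge0. Qed.

(** Bessel's inequality for the pole [e0]; it supplies the bound on the
    coefficients of Kepler's equation. *)
Lemma bessel_e0 X Z : inner X X = 1 -> inner Z Z = 1 -> inner X Z = 0 ->
  X.1 ^+ 2 + Z.1 ^+ 2 <= 1.
Proof.
move=> XX ZZ XZ.
have := inner_ge0 (e0 R - (X.1 *: X + Z.1 *: Z)).
rewrite !innerE XX ZZ XZ (innerC Z X) XZ (innerC X (e0 R)) (innerC Z (e0 R)) !inner_e0.
have -> : (e0 R).1 = 1 by [].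
move=> h; nra.
Qed.

Lemma inner_eq_e0 X : inner X X = 1 -> X.1 = 1 -> X = e0 R.
Proof.
move=> XX X1; apply/eqP; rewrite -subr_eq0; apply/negPn/negP => /inner_gt0.
rewrite !innerE XX (innerC X (e0 R)) !inner_e0 X1.
have -> : (e0 R).1 = 1 by [].
lra.
Qed.

Lemma vec4_eqP X Y : X.1 = Y.1 -> (forall i, X.2 0 i = Y.2 0 i) -> X = Y.
Proof. by move=> e1 e2; apply: injective_projections => //; apply/rowP. Qed.

Lemma vec4_rotK (c s : R) X Z : c ^+ 2 + s ^+ 2 = 1 ->
  s *: (s *: X + c *: Z) - c *: (- (c *: X) + s *: Z) = X /\
  c *: (s *: X + c *: Z) + s *: (- (c *: X) + s *: Z) = Z.
Proof.
move=> E; split.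
  rewrite -[RHS]scale1r -E; apply: vec4_eqP => [|i] /=; rewrite ?mxE /GRing.scale /=; ring.
rewrite -[RHS]scale1r -E; apply: vec4_eqP => [|i] /=; rewrite ?mxE /GRing.scale /=; ring.
Qed.

Lemma vec4_rotVK (c s : R) X Z : c ^+ 2 + s ^+ 2 = 1 ->
  s *: (s *: X - c *: Z) + c *: (c *: X + s *: Z) = X /\
  - (c *: (s *: X - c *: Z)) + s *: (c *: X + s *: Z) = Z.
Proof.
move=> E; split.
  rewrite -[RHS]scale1r -E; apply: vec4_eqP => [|i] /=; rewrite ?mxE /GRing.scale /=; ring.
rewrite -[RHS]scale1r -E; apply: vec4_eqP => [|i] /=; rewrite ?mxE /GRing.scale /=; ring.
Qed.

Definition orthonormal2 X Z := [/\ inner X X = 1, inner Z Z = 1 & inner X Z = 0].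

(** With [(c, s) = (cos phi, sin phi)] this turns [(alpha, beta)] into position
    and unit momentum, as in [Phi]; with [c] negated it turns them back. *)
Lemma orthonormal2_rot (c s : R) X Z : c ^+ 2 + s ^+ 2 = 1 -> orthonormal2 X Z ->
  orthonormal2 (s *: X + c *: Z) (- (c *: X) + s *: Z).
Proof.
move=> E [XX ZZ XZ]; split; rewrite !innerE XX ZZ XZ (innerC Z X) XZ; lra.
Qed.

(* Kepler kepler_data *)
Section Elements.
Variables (gamma n r : R) (x p : 'rV[R]_3).
Hypothesis g0 : 0 < gamma.

(** Position, momentum and radius at one instant of a Euclidean Kepler motion
    with energy [- gamma ^+ 2 / (2 * n ^+ 2)]; the last condition is the energy
    equation. *)
Definition kepler_data : Prop :=
  [/\ 0 < n, 0 < r, dot x x = r ^+ 2 &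
      dot p p = 2 * gamma / r - gamma ^+ 2 / n ^+ 2].

(** [ls_alpha] and [ls_beta] are the vectors of the Ligon-Schaaf map of the
    Euclidean Kepler problem.  In these coordinates [alpha] and [beta] have no
    reference to the sphere any more. *)
Definition ls_alpha : vec4 R :=
  (dot x p / n, r^-1 *: x - (dot x p / gamma) *: p).
Definition ls_beta : vec4 R :=
  (r * dot p p / gamma - 1, (r / n) *: p).

Hypothesis el : kepler_data.

Let n0 : n != 0. Proof. by case: el => h _ _ _; rewrite gt_eqF. Qed.
Let r0 : r != 0. Proof. by case: el => _ h _ _; rewrite gt_eqF. Qed.
Let g1 : gamma != 0. Proof. by rewrite gt_eqF. Qed.

Lemma ls_beta1 : ls_beta.1 = 1 - gamma * r / n ^+ 2.
Proof. by case: el => _ _ _; rewrite /ls_beta /= => ->; field; rewrite n0 r0 g1. Qed.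

Lemma ls_orthonormal : orthonormal2 ls_alpha ls_beta.
Proof.
case: el => _ _ xx pp; rewrite /ls_alpha /ls_beta.
split; rewrite /inner /= !dotE ?(dotC p x) ?xx pp; field; by rewrite ?n0 ?r0 ?g1.
Qed.

End Elements.
End Geometry.

(** * Gnomonic projection of the Kepler problem *)

Section Bijection.
Context {R : realType} (gamma : R) (g0 : 0 < gamma).
Implicit Types (z w : phase R).

Let g1 : gamma != 0. Proof. by rewrite gt_eqF. Qed.

Lemma ord3_cyc : [/\ (0 + 1 = 1 :> 'I_3), (0 + 2 = 2 :> 'I_3), (1 + 1 = 2 :> 'I_3),
  (1 + 2 = 0 :> 'I_3) & (2 + 1 = 0 :> 'I_3) /\ (2 + 2 = 1 :> 'I_3)].
Proof. by split; last split; apply: val_inj. Qed.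

Lemma sum_ord3 (f : 'I_3 -> R) : \sum_i f i = f 0 + f 1 + f 2.
Proof.
rewrite !big_ord_recl big_ord0 addr0 addrA.
by congr (_ + f _ + f _); apply: val_inj.
Qed.

(** Lagrange's identity. *)
Lemma dot_cross (u w : 'rV[R]_3) :
  dot (cross u w) (cross u w) = dot u u * dot w w - dot u w ^+ 2.
Proof.
have [e1 e2 e3 e4 [e5 e6]] := ord3_cyc.
rewrite /dot !sum_ord3 !mxE e1 e2 e3 e4 e5 e6; ring.
Qed.

Lemma TS3_dot z : TS3 z ->
  dot z.1.2 z.1.2 = 1 - z.1.1 ^+ 2 /\ dot z.1.2 z.2.2 = - (z.1.1 * z.2.1).
Proof. by case: z => [[q0 q] [v0 v]] [/=]; rewrite /inner /= => h1 h2; split; lra. Qed.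

(** On [TS3] the kinetic energy splits as [dot mu mu + dot pi pi], because the
    entries of [mu] and [pi_] are the six Pluecker coordinates of the
    orthogonal vectors [q] and [v] with [inner q q = 1]. *)
Lemma energyE z : TS3 z ->
  energy gamma z = dot (pi_ z) (pi_ z) / 2 - gamma * (z.1.1 / Num.sqrt (1 - z.1.1 ^+ 2)).
Proof.
move=> Tz; have [qq qv] := TS3_dot Tz; move: z Tz qq qv => [[q0 q] [v0 v]] Tz /= qq qv.
rewrite /energy /kepler_H /mu /pi_ dot_cross /= !dotE (dotC v q) qq qv /inner /=.
ring.
Qed.

(** Central projection of the hemisphere [q_0 > 0] to its tangent space at
    [e0].  Together with the momentum [pi_] and the time [ds = dt / q_0 ^+ 2]
    it turns the Kepler problem on the sphere into the Euclidean one. *)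
Definition gnomonic z : 'rV[R]_3 := z.1.1^-1 *: z.1.2.
Definition radius z : R := norm3 z.1.2 / z.1.1.

Lemma kepler_neg_pos z : kepler_neg gamma z -> 0 < z.1.1 /\ z.1.1 ^+ 2 < 1.
Proof.
move=> [[Tz q1] E]; have [qq _] := TS3_dot Tz.
have h : z.1.1 ^+ 2 < 1.
  by rewrite lt_neqAle q1 -subr_ge0 -qq dot_ge0.
split=> //; have s0 : 0 < Num.sqrt (1 - z.1.1 ^+ 2) by rewrite sqrtr_gt0 subr_gt0.
move: E; rewrite energyE // => E; have pp := dot_ge0 (pi_ z).
have : 0 < gamma * (z.1.1 / Num.sqrt (1 - z.1.1 ^+ 2)) by lra.
by rewrite pmulr_rgt0 // pmulr_lgt0 // invr_gt0.
Qed.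

Lemma norm3_sqrt z : TS3 z -> norm3 z.1.2 = Num.sqrt (1 - z.1.1 ^+ 2).
Proof. by move=> /TS3_dot [<- _]. Qed.

Lemma radius_gt0 z : kepler_neg gamma z -> 0 < radius z.
Proof.
move=> Kz; have [q0 q1] := kepler_neg_pos Kz; case: Kz => [[Tz _] _].
by rewrite divr_gt0 // norm3_sqrt // sqrtr_gt0 subr_gt0.
Qed.

(** The factor of the time change, in terms of the projected position. *)
Lemma radius_sqr z : kepler_neg gamma z ->
  1 + radius z ^+ 2 = (z.1.1 ^+ 2)^-1.
Proof.
move=> Kz; have [q0 q1] := kepler_neg_pos Kz; case: Kz => [[Tz _] _].
rewrite /radius norm3_sqrt // expr_div_n sqr_sqrtr ?subr_ge0 ?ltW //.
by field; rewrite gt_eqF.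
Qed.

Lemma energy_radius z : kepler_neg gamma z ->
  energy gamma z = dot (pi_ z) (pi_ z) / 2 - gamma / radius z.
Proof.
move=> Kz; have [q0 q1] := kepler_neg_pos Kz; case: Kz => [[Tz _] _].
by rewrite energyE // /radius norm3_sqrt // invf_div.
Qed.

Lemma nu_gt0 z : kepler_neg gamma z -> 0 < nu gamma z.
Proof.
move=> [_ E]; rewrite divr_gt0 // sqrtr_gt0; lra.
Qed.

Lemma nu_sqr z : kepler_neg gamma z -> gamma ^+ 2 / nu gamma z ^+ 2 = - 2 * energy gamma z.
Proof.
move=> [_ E]; rewrite /nu expr_div_n sqr_sqrtr; last lra.
by field; rewrite g1 lt_eqF.
Qed.

(** The constant of motion [energy] is the Euclidean Kepler energy of the
    projected state. *)
Lemma kepler_neg_data z : kepler_neg gamma z ->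
  kepler_data gamma (nu gamma z) (radius z) (gnomonic z) (pi_ z).
Proof.
move=> Kz; split; [exact: nu_gt0|exact: radius_gt0| |].
- have [q0 q1] := kepler_neg_pos Kz; have := radius_sqr Kz.
  case: Kz => [[Tz _] _]; have [qq _] := TS3_dot Tz.
  rewrite /gnomonic !dotE qq => /(canRL (addKr _)) ->.
  by field; rewrite gt_eqF.
- by rewrite nu_sqr // energy_radius //; lra.
Qed.

Lemma alphaE z : kepler_neg gamma z ->
  alpha gamma z = ls_alpha gamma (nu gamma z) (radius z) (gnomonic z) (pi_ z).
Proof.
move=> Kz; have [q0 q1] := kepler_neg_pos Kz; have n0 := nu_gt0 Kz.
have r0 := radius_gt0 Kz.
have s0 : norm3 z.1.2 != 0.
  by apply: contraTneq r0; rewrite /radius => ->; rewrite mul0r ltxx.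
rewrite /alpha /ls_alpha; congr (_, _).
  by rewrite /gnomonic !dotE; field; rewrite !gt_eqF.
congr (_ - _ *: _); last by rewrite /gnomonic !dotE; field; rewrite g1 gt_eqF.
by rewrite /gnomonic scalerA; congr (_ *: _); rewrite /radius; field; rewrite s0 gt_eqF.
Qed.

Lemma betaE z : kepler_neg gamma z ->
  beta gamma z = ls_beta gamma (nu gamma z) (radius z) (pi_ z).
Proof.
move=> Kz; have [q0 q1] := kepler_neg_pos Kz; have n0 := nu_gt0 Kz.
rewrite /beta /ls_beta /radius; congr (_, _ *: _); last by field; rewrite !gt_eqF.
by congr (_ - 1); field; rewrite g1 gt_eqF.
Qed.

Lemma phiE z : phi gamma z = (alpha gamma z).1.
Proof. by []. Qed.

Lemma Phi_orthonormal z : kepler_neg gamma z ->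
  orthonormal2 (Phi gamma z).1 ((nu gamma z)^-1 *: (Phi gamma z).2).
Proof.
move=> Kz; have n0 := nu_gt0 Kz.
rewrite /Phi /= scalerA mulVf ?gt_eqF // scale1r.
apply: orthonormal2_rot; first exact: cos2Dsin2.
by rewrite alphaE // betaE //; apply: ls_orthonormal => //; exact: kepler_neg_data.
Qed.

(** Since [phi] is the first coordinate of [alpha], the first equation contains
    [phi = X_0 sin phi - Z_0 cos phi]: Kepler's equation for [phi], with
    coefficients depending only on [Phi gamma z].  This is why [Phi] can be
    inverted. *)
Lemma Phi_kepler_eq z (f := phi gamma z) (X := (Phi gamma z).1)
    (Z := (nu gamma z)^-1 *: (Phi gamma z).2) : kepler_neg gamma z ->
  sin f *: X - cos f *: Z = alpha gamma z /\ cos f *: X + sin f *: Z = beta gamma z.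
Proof.
move=> Kz; have n0 := nu_gt0 Kz.
have -> : Z = - (cos f *: alpha gamma z) + sin f *: beta gamma z.
  by rewrite /Z /Phi /= scalerA mulVf ?gt_eqF // scale1r.
have -> : X = sin f *: alpha gamma z + cos f *: beta gamma z by [].
exact: vec4_rotK (cos2Dsin2 f).
Qed.

End Bijection.

(** * The inverse of Phi *)

Section Inverse.
Context {R : realType} (gamma : R) (g0 : 0 < gamma).
Implicit Types (z w : phase R) (x p : 'rV[R]_3).

Let g1 : gamma != 0. Proof. by rewrite gt_eqF. Qed.

(** Inverse of the gnomonic projection on states; [u] stands for [dot x p]. *)
Definition lift_state (r u : R) x p : phase R :=
  let k := (Num.sqrt (1 + r ^+ 2))^-1 in
  ((k, k *: x), (- (u * k), k^-1 *: p - (u * k) *: x)).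

Lemma lift_k (r : R) (k := (Num.sqrt (1 + r ^+ 2))^-1) :
  0 < k /\ k ^+ 2 = (1 + r ^+ 2)^-1.
Proof.
have h : 0 < 1 + r ^+ 2 by rewrite ltr_pwDl // sqr_ge0.
by rewrite /k invr_gt0 sqrtr_gt0 h exprVn sqr_sqrtr // ltW.
Qed.

Lemma dot_combl (a b c : R) x p :
  dot (a *: x + b *: p) (c *: p) = c * (a * dot x p + b * dot p p).
Proof. by rewrite !dotE; ring. Qed.

Lemma dot_comb (a b : R) x p : dot (a *: x + b *: p) (a *: x + b *: p) =
  a ^+ 2 * dot x x + 2 * a * b * dot x p + b ^+ 2 * dot p p.
Proof. by rewrite !dotE (dotC p x); ring. Qed.

Lemma dot_sqrZ (a : R) p : dot (a *: p) (a *: p) = a ^+ 2 * dot p p.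
Proof. by rewrite !dotE; ring. Qed.

Lemma lift_gnomonic r u x p : gnomonic (lift_state r u x p) = x.
Proof.
have [k0 _] := lift_k r.
by rewrite /gnomonic /lift_state /= scalerA mulVf ?scale1r // gt_eqF.
Qed.

Lemma lift_pi r u x p : pi_ (lift_state r u x p) = p.
Proof.
have [k0 _] := lift_k r; rewrite /pi_ /lift_state /=; set k := (Num.sqrt _)^-1 in k0 *.
by apply/rowP => i; rewrite !mxE; field; rewrite gt_eqF.
Qed.

Lemma lift_data (n r : R) x p (z := lift_state r (dot x p) x p) :
  kepler_data gamma n r x p -> kepler_neg gamma z /\ nu gamma z = n /\ radius z = r.
Proof.
move=> [n0 r0 xx pp]; have [k0 k2] := lift_k r.
have h : 0 < 1 + r ^+ 2 by rewrite ltr_pwDl // sqr_ge0.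
have k2h : (Num.sqrt (1 + r ^+ 2))^-1 ^+ 2 * (1 + r ^+ 2) = 1.
  by rewrite k2 mulVf // gt_eqF.
have Tz : TS3 z.
  rewrite /z /lift_state; set k := (Num.sqrt _)^-1 in k0 k2 k2h *.
  split; rewrite /inner /= !dotE xx; first by rewrite -[RHS]k2h; ring.
  rewrite (_ : _ + _ = (dot x p) * (1 - k ^+ 2 * (1 + r ^+ 2))).
    by rewrite k2h subrr mulr0.
  by field; rewrite gt_eqF.
have q1 : z.1.1 ^+ 2 != 1.
  have r2 : 0 < r ^+ 2 by rewrite exprn_gt0.
  by rewrite /z /= k2; apply/eqP => /(congr1 GRing.inv); rewrite invrK invr1; lra.
have s1 : norm3 z.1.2 / z.1.1 = r.
  rewrite /norm3 /z /=; set k := (Num.sqrt _)^-1 in k0 k2 k2h *.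
  have -> : dot (k *: x) (k *: x) = (k * r) ^+ 2 by rewrite !dotE xx; ring.
  by rewrite sqrtr_sqr ger0_norm ?mulr_ge0 ?ltW // mulrC mulKf // gt_eqF.
have En : energy gamma z = - (gamma ^+ 2 / n ^+ 2) / 2.
  rewrite energyE // lift_pi -norm3_sqrt // pp -[z.1.1 / _]invf_div s1; lra.
have gn : 0 < gamma ^+ 2 / n ^+ 2 by rewrite divr_gt0 // exprn_gt0.
split; first by split=> //; rewrite En; lra.
split=> //; rewrite /nu En.
have -> : - 2 * (- (gamma ^+ 2 / n ^+ 2) / 2) = (gamma / n) ^+ 2.
  by rewrite expr_div_n; field; rewrite gt_eqF.
by rewrite sqrtr_sqr ger0_norm ?divr_ge0 ?ltW // invf_div mulrC mulfVK.
Qed.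

(** The radial component satisfies [dot x p = - v_0 / q_0]. *)
Lemma lift_kepler z : kepler_neg gamma z ->
  lift_state (radius z) (dot (gnomonic z) (pi_ z)) (gnomonic z) (pi_ z) = z.
Proof.
move=> Kz; have [q0 q1] := kepler_neg_pos g0 Kz.
have kE : (Num.sqrt (1 + radius z ^+ 2))^-1 = z.1.1.
  by rewrite (radius_sqr g0 Kz) sqrtrV ?sqr_ge0 // sqrtr_sqr gtr0_norm // invrK.
case: Kz => [[Tz _] _]; have [qq qv] := TS3_dot Tz.
have uE : dot (gnomonic z) (pi_ z) = - (z.2.1 / z.1.1).
  rewrite /gnomonic; move: z q0 qq qv {q1 kE Tz} => [[q0 q] [v0 v]] /= q00 qq qv.
  by rewrite /pi_ !dotE qq qv; field; rewrite gt_eqF.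
rewrite /lift_state kE uE /gnomonic.
move: z q0 {q1 kE Tz qq qv uE} => [[q0 q] [v0 v]] /= q00.
have qn : q0 != 0 by rewrite gt_eqF.
congr (_, _); congr (_, _); first by rewrite scalerA mulfV // scale1r.
  by rewrite mulNr opprK mulfVK.
by apply/rowP => i; rewrite !mxE; field.
Qed.

(** The momentum normalised, so that position and unit momentum form an
    orthonormal pair. *)
Definition Psi_unit w : vec4 R := (Num.sqrt (inner w.2 w.2))^-1 *: w.2.
Lemma TplusS3_nu w (n := Num.sqrt (inner w.2 w.2)) : TplusS3 w ->
  [/\ 0 < n, n ^+ 2 = inner w.2 w.2, w.2 = n *: Psi_unit w & orthonormal2 w.1 (Psi_unit w)].
Proof.
move=> [[xx xy] y0]; have h := inner_gt0 y0.
have n0 : 0 < n by rewrite /n sqrtr_gt0.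
have n2 : n ^+ 2 = inner w.2 w.2 by rewrite sqr_sqrtr // ltW.
split=> //; first by rewrite /Psi_unit scalerA mulfV ?scale1r // gt_eqF.
split=> //; rewrite /Psi_unit -/n !innerE ?xy ?mulr0 // -n2.
by field; rewrite gt_eqF.
Qed.

Definition Psi_phi w : R := kepler_sol w.1.1 (Psi_unit w).1.
Definition Psi_alpha w : vec4 R :=
  sin (Psi_phi w) *: w.1 - cos (Psi_phi w) *: Psi_unit w.
Definition Psi_beta w : vec4 R :=
  cos (Psi_phi w) *: w.1 + sin (Psi_phi w) *: Psi_unit w.
(** Obtained by solving [beta_0 = 1 - gamma * r / n ^+ 2] for [r], see
    [ls_beta1]; [Psi_pi] and [Psi_gnomonic] solve [ls_beta] and [ls_alpha] for
    [p] and [x] in the same way. *)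
Definition Psi_radius w : R := inner w.2 w.2 * (1 - (Psi_beta w).1) / gamma.
Definition Psi_pi w : 'rV[R]_3 :=
  (Num.sqrt (inner w.2 w.2) / Psi_radius w) *: (Psi_beta w).2.
Definition Psi_gnomonic w : 'rV[R]_3 :=
  Psi_radius w *: (Psi_alpha w).2 +
  (inner w.2 w.2 * Psi_phi w / gamma) *: (Psi_beta w).2.

Definition Psi w : phase R :=
  lift_state (Psi_radius w) (Num.sqrt (inner w.2 w.2) * Psi_phi w)
    (Psi_gnomonic w) (Psi_pi w).

Section OnDomain.
Variable w : phase R.
Hypothesis Dw : delaunay_domain w.
Let n := Num.sqrt (inner w.2 w.2).

Lemma delaunay_nu : 0 < n /\ n ^+ 2 = inner w.2 w.2.
Proof. by have [n0 n2 _ _] := TplusS3_nu Dw.1. Qed.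

Lemma delaunay_orthonormal : orthonormal2 w.1 (Psi_unit w).
Proof. by have [_ _ _ o] := TplusS3_nu Dw.1. Qed.

Lemma delaunay_le1 : w.1.1 ^+ 2 + (Psi_unit w).1 ^+ 2 <= 1.
Proof. by have [a b c] := delaunay_orthonormal; exact: bessel_e0. Qed.

Lemma delaunay_neq1 : w.1.1 != 1.
Proof.
have [[[xx _] _]] := Dw; apply: contra => /eqP x1.
by rewrite (inner_eq_e0 xx x1).
Qed.

Lemma Psi_alpha1 : (Psi_alpha w).1 = Psi_phi w.
Proof.
rewrite [RHS](kepler_solP delaunay_le1) -/(Psi_phi w) /Psi_alpha /= /GRing.scale /=.
by ring.
Qed.

(** Nondegeneracy of Kepler's equation, and thereby positivity of the
    reconstructed radius; both fail when the position is the pole. *)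
Lemma Psi_beta1 : 0 < 1 - (Psi_beta w).1.
Proof.
have := kepler_sol_nondeg delaunay_le1 delaunay_neq1; rewrite -/(Psi_phi w).
by rewrite /Psi_beta /= /GRing.scale /= (mulrC w.1.1) (mulrC (Psi_unit w).1).
Qed.

Lemma Psi_orthonormal : orthonormal2 (Psi_alpha w) (Psi_beta w).
Proof.
have E : (- cos (Psi_phi w)) ^+ 2 + sin (Psi_phi w) ^+ 2 = 1 by rewrite sqrrN cos2Dsin2.
by have := orthonormal2_rot E delaunay_orthonormal; rewrite !scaleNr opprK.
Qed.

Lemma Psi_dots : [/\ dot (Psi_alpha w).2 (Psi_alpha w).2 = 1 - Psi_phi w ^+ 2,
  dot (Psi_beta w).2 (Psi_beta w).2 = 1 - (Psi_beta w).1 ^+ 2 &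
  dot (Psi_alpha w).2 (Psi_beta w).2 = - (Psi_phi w * (Psi_beta w).1)].
Proof.
have [] := Psi_orthonormal; rewrite /inner Psi_alpha1 => a b c; split; lra.
Qed.

Lemma Psi_radius_gt0 : 0 < Psi_radius w.
Proof.
have [n0 n2] := delaunay_nu; rewrite /Psi_radius -n2.
by rewrite divr_gt0 // mulr_gt0 ?exprn_gt0 // Psi_beta1.
Qed.

Lemma Psi_radiusE : (Psi_beta w).1 = 1 - gamma * Psi_radius w / n ^+ 2.
Proof.
have [n0 n2] := delaunay_nu; rewrite /Psi_radius n2 -n2.
by field; rewrite g1 gt_eqF.
Qed.

Lemma Psi_dot : dot (Psi_gnomonic w) (Psi_pi w) = n * Psi_phi w.
Proof.
have [n0 n2] := delaunay_nu; have [aa bb ab] := Psi_dots; have r0 := Psi_radius_gt0.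
rewrite /Psi_gnomonic /Psi_pi dot_combl bb ab -/n -n2 Psi_radiusE.
by field; rewrite g1 !gt_eqF.
Qed.

(** The length of the reconstructed position follows from the orthonormality
    of [Psi_alpha] and [Psi_beta] alone. *)
Lemma Psi_data : kepler_data gamma n (Psi_radius w) (Psi_gnomonic w) (Psi_pi w).
Proof.
have [n0 n2] := delaunay_nu; have [aa bb ab] := Psi_dots; have r0 := Psi_radius_gt0.
split=> //.
  rewrite /Psi_gnomonic dot_comb aa bb ab -n2 Psi_radiusE.
  by field; rewrite g1 !gt_eqF.
rewrite /Psi_pi dot_sqrZ bb Psi_radiusE -/n.
by field; rewrite !gt_eqF.
Qed.

Lemma Psi_kepler : [/\ kepler_neg gamma (Psi w), nu gamma (Psi w) = n,
  radius (Psi w) = Psi_radius w, gnomonic (Psi w) = Psi_gnomonic w &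
  pi_ (Psi w) = Psi_pi w].
Proof.
rewrite /Psi -/n -Psi_dot; have [a [b c]] := lift_data Psi_data.
by split=> //; [exact: lift_gnomonic|exact: lift_pi].
Qed.

Lemma Psi_alphaE : alpha gamma (Psi w) = Psi_alpha w.
Proof.
have [K en er ex ep] := Psi_kepler; have [n0 n2] := delaunay_nu.
have r0 := Psi_radius_gt0.
rewrite alphaE // en er ex ep /ls_alpha Psi_dot.
apply: vec4_eqP => [|i]; first by rewrite Psi_alpha1 [LHS]/=; field; rewrite gt_eqF.
rewrite [LHS]/= /Psi_gnomonic /Psi_pi -/n -n2 !mxE; field.
by rewrite g1 !gt_eqF.
Qed.

Lemma Psi_betaE : beta gamma (Psi w) = Psi_beta w.
Proof.
have [K en er ex ep] := Psi_kepler; have [n0 n2] := delaunay_nu.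
have r0 := Psi_radius_gt0.
rewrite betaE // en er ep; apply: vec4_eqP => [|i].
  by rewrite (ls_beta1 g0 Psi_data) Psi_radiusE.
by rewrite /ls_beta /Psi_pi -/n !mxE; field; rewrite !gt_eqF.
Qed.

Lemma PsiK : Phi gamma (Psi w) = w.
Proof.
have [K en er ex ep] := Psi_kepler; have [n0 n2] := delaunay_nu.
rewrite /Phi phiE Psi_alphaE Psi_betaE Psi_alpha1 en.
have [e1 e2] := vec4_rotVK w.1 (Psi_unit w) (cos2Dsin2 (Psi_phi w)).
rewrite /Psi_alpha /Psi_beta e1 e2 /Psi_unit -/n scalerA mulfV ?gt_eqF // scale1r.
by case: (w).
Qed.

End OnDomain.

(** If the position of [Phi gamma z] were [e0], pairing it with [alpha] and
    [beta] would give [sin phi = phi] and [cos phi = beta_0], so [phi = 0] and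
    [beta_0 = 1], against [beta_0 = 1 - gamma * r / nu ^+ 2 < 1]. *)
Lemma Phi_domain z : kepler_neg gamma z -> delaunay_domain (Phi gamma z).
Proof.
move=> Kz; have n0 := nu_gt0 g0 Kz; have el := kepler_neg_data g0 Kz.
have [XX ZZ XZ] := Phi_orthonormal g0 Kz.
have Y0 : (Phi gamma z).2 != 0.
  apply/eqP => Y0; move: ZZ; rewrite Y0 scaler0 -(scale0r 0) innerZl mul0r.
  by move/eqP; rewrite eq_sym oner_eq0.
split; first split=> //.
  split=> //; move: XZ; rewrite innerZR => /eqP.
  by rewrite mulf_eq0 invr_eq0 gt_eqF //= => /eqP.
apply/eqP => Xe; have [ea eb] := Phi_kepler_eq g0 Kz.
have [AA BB AB] := ls_orthonormal g0 el.
rewrite -alphaE // in AA AB; rewrite -betaE // in AB BB.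
have Xa : inner (alpha gamma z) (Phi gamma z).1 = sin (phi gamma z).
  by rewrite /Phi /= !innerE AA AB mulr0 addr0 mulr1.
have Xb : inner (beta gamma z) (Phi gamma z).1 = cos (phi gamma z).
  by rewrite /Phi /= !innerE BB (innerC (beta _ _)) AB mulr0 add0r mulr1.
rewrite Xe innerC inner_e0 -phiE in Xa; rewrite Xe innerC inner_e0 in Xb.
have f0 : phi gamma z = 0.
  apply/eqP/negPn/negP => /sin_sqr_lt; rewrite -Xa ltxx //.
move: Xb; rewrite betaE // (ls_beta1 g0 el) f0 cos0.
have : 0 < gamma * radius z / nu gamma z ^+ 2.
  have r0 := radius_gt0 g0 Kz; apply: divr_gt0; last exact: exprn_gt0.
  exact: mulr_gt0.
lra.
Qed.

Lemma PhiK z : kepler_neg gamma z -> Psi (Phi gamma z) = z.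
Proof.
move=> Kz; have n0 := nu_gt0 g0 Kz; have el := kepler_neg_data g0 Kz.
have [_ r0 xx pp] := el.
have Dw := Phi_domain Kz; set w := Phi gamma z in Dw *.
have [XX ZZ XZ] := Phi_orthonormal g0 Kz; rewrite -/w in XX ZZ XZ.
have nE : Num.sqrt (inner w.2 w.2) = nu gamma z.
  have -> : inner w.2 w.2 = nu gamma z ^+ 2 * inner ((nu gamma z)^-1 *: w.2) ((nu gamma z)^-1 *: w.2).
    by rewrite !innerE; field; rewrite gt_eqF.
  by rewrite ZZ mulr1 sqrtr_sqr gtr0_norm.
have [_ n2] := delaunay_nu Dw; rewrite nE in n2.
have ZE : Psi_unit w = (nu gamma z)^-1 *: w.2 by rewrite /Psi_unit nE.
have [ea eb] := Phi_kepler_eq g0 Kz; rewrite -/w -ZE in ea eb.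
have fE : Psi_phi w = phi gamma z.
  apply/esym/kepler_sol_uniq; first exact: delaunay_le1.
  rewrite {1}phiE -ea /= /GRing.scale /=; ring.
have aE : Psi_alpha w = alpha gamma z by rewrite /Psi_alpha fE.
have bE : Psi_beta w = beta gamma z by rewrite /Psi_beta fE.
have rE : Psi_radius w = radius z.
  rewrite /Psi_radius bE betaE // (ls_beta1 g0 el) -n2.
  by field; rewrite g1 gt_eqF.
have pE : Psi_pi w = pi_ z.
  rewrite /Psi_pi nE rE bE betaE // /ls_beta /= scalerA -[RHS]scale1r; congr (_ *: _).
  by field; rewrite !gt_eqF.
have phE : phi gamma z = dot (gnomonic z) (pi_ z) / nu gamma z.
  by rewrite phiE alphaE.
have [q0 _] := kepler_neg_pos g0 Kz.
have xE : Psi_gnomonic w = gnomonic z.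
  rewrite /Psi_gnomonic rE fE phE aE bE alphaE // betaE // -n2; apply/rowP => i.
  by rewrite /ls_alpha /ls_beta /= !mxE; field; rewrite g1 !gt_eqF.
rewrite /Psi rE nE xE pE fE phE mulrC mulfVK ?gt_eqF //.
exact: lift_kepler.
Qed.

Lemma Phi_bij : set_bij (kepler_neg gamma) (@delaunay_domain R) (Phi gamma).
Proof.
split.
- by move=> z /Phi_domain.
- by move=> z z'; rewrite !inE => Kz Kz' E; rewrite -(PhiK Kz) E PhiK.
- by move=> w Dw; exists (Psi w); [case: (Psi_kepler Dw)|exact: PsiK].
Qed.

End Inverse.

(** * The Delaunay flow is a rotation *)

Section Rotation.
Context {R : realType} (gamma : R) (g0 : 0 < gamma).
Implicit Types (w : phase R) (s t : R).

Definition rotation w s : phase R :=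
  let n := Num.sqrt (inner w.2 w.2) in let th := gamma ^+ 2 / n ^+ 3 * s in
  (cos th *: w.1 + sin th *: Psi_unit w,
   n *: (- (sin th *: w.1) + cos th *: Psi_unit w)).

Lemma rotation0 w : TplusS3 w -> rotation w 0 = w.
Proof.
move=> /TplusS3_nu [_ _ e _]; rewrite /rotation mulr0 cos0 sin0.
rewrite !scale1r !scale0r oppr0 addr0 add0r -e; by case: w e.
Qed.

Lemma rotation_orthonormal w s : TplusS3 w ->
  orthonormal2 (rotation w s).1 ((Num.sqrt (inner w.2 w.2))^-1 *: (rotation w s).2).
Proof.
move=> /TplusS3_nu [n0 _ _ o].
rewrite /rotation /= scalerK ?gt_eqF //.
by apply: orthonormal2_rot => //; rewrite addrC cos2Dsin2.
Qed.

Lemma rotation_inner w s : TplusS3 w ->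
  inner (rotation w s).2 (rotation w s).2 = inner w.2 w.2.
Proof.
move=> Tw; have [n0 n2 _ _] := TplusS3_nu Tw.
have [_ E _] := rotation_orthonormal s Tw.
rewrite innerZl innerZR in E; rewrite -n2.
set m := inner (rotation w s).2 _ in E *; set n := Num.sqrt _ in n0 E *.
have -> : m = n ^+ 2 * (n^-1 * (n^-1 * m)) by field; rewrite gt_eqF.
by rewrite E mulr1.
Qed.

Lemma rotation_TplusS3 w s : TplusS3 w -> TplusS3 (rotation w s).
Proof.
move=> Tw; have [n0 n2 _ _] := TplusS3_nu Tw.
have [XX ZZ XZ] := rotation_orthonormal s Tw.
split; first split=> //.
  move: XZ; rewrite innerZR => /eqP.
  by rewrite mulf_eq0 invr_eq0 gt_eqF //= => /eqP.
apply/eqP => y0; move: ZZ; rewrite y0 scaler0 -(scale0r 0) innerZl mul0r.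
by move/eqP; rewrite eq_sym oner_eq0.
Qed.

Lemma rotation_unit w s : TplusS3 w -> Psi_unit (rotation w s) =
  (Num.sqrt (inner w.2 w.2))^-1 *: (rotation w s).2.
Proof. by move=> Tw; rewrite /Psi_unit rotation_inner. Qed.

Lemma is_derive_sin_comp (f : R -> R) t df : is_derive t (1 : R) f df ->
  is_derive t (1 : R) (fun s => sin (f s)) (cos (f t) * df).
Proof. by move=> F; exact: is_derive1_comp. Qed.

Lemma is_derive_cos_comp (f : R -> R) t df : is_derive t (1 : R) f df ->
  is_derive t (1 : R) (fun s => cos (f s)) (- sin (f t) * df).
Proof. by move=> F; exact: is_derive1_comp. Qed.

(** Shared by the rotation flow and by [Phi] and [Psi], where both the angle
    and the two vectors move. *)
Lemma is_derive_turn (f : R -> R) (A B : R -> vec4 R) t df dA dB :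
  is_derive t (1 : R) f df -> is_derive t (1 : R) A dA -> is_derive t (1 : R) B dB ->
  is_derive t (1 : R) (fun s => cos (f s) *: A s + sin (f s) *: B s)
    (cos (f t) *: dA + sin (f t) *: dB +
     df *: (- (sin (f t) *: A t) + cos (f t) *: B t)).
Proof.
move=> F DA DB.
have H := is_deriveD (is_derive_scale_vec4 (is_derive_cos_comp F) DA)
  (is_derive_scale_vec4 (is_derive_sin_comp F) DB).
apply: (is_derive_eq (is_derive_ext _ H)) => //.
apply: vec4_eqP => [|i] /=; rewrite ?mxE /GRing.scale /=; ring.
Qed.

Lemma is_derive_turn_perp (f : R -> R) (A B : R -> vec4 R) t df dA dB :
  is_derive t (1 : R) f df -> is_derive t (1 : R) A dA -> is_derive t (1 : R) B dB ->
  is_derive t (1 : R) (fun s => - (sin (f s) *: A s) + cos (f s) *: B s)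
    (- (sin (f t) *: dA) + cos (f t) *: dB -
     df *: (cos (f t) *: A t + sin (f t) *: B t)).
Proof.
move=> F DA DB.
have H := is_deriveD (is_deriveN (is_derive_scale_vec4 (is_derive_sin_comp F) DA))
  (is_derive_scale_vec4 (is_derive_cos_comp F) DB).
apply: (is_derive_eq (is_derive_ext _ H)) => //.
apply: vec4_eqP => [|i] /=; rewrite ?mxE /GRing.scale /=; ring.
Qed.

Lemma is_derive_scale_cst (W : normedModType R) (k : R) (f : R -> W) t df :
  is_derive t (1 : R) f df -> is_derive t (1 : R) (fun s => k *: f s) (k *: df).
Proof. by move=> F; have := is_deriveZ k F. Qed.

Lemma is_derive_mul_cst (k : R) (f : R -> R) t df :
  is_derive t (1 : R) f df -> is_derive t (1 : R) (fun s => k * f s) (k * df).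
Proof. exact: is_derive_scale_cst. Qed.

Lemma rotation_derive w s : TplusS3 w ->
  is_derive s (1 : R) (rotation w) (delaunay_X gamma (rotation w s)).
Proof.
move=> Tw; have [n0 n2 _ _] := TplusS3_nu Tw; set n := Num.sqrt _ in n0 n2 *.
have F := is_derive_mul_cst (gamma ^+ 2 / n ^+ 3) (is_derive_id s 1).
have cX := is_derive_cst w.1 s 1; have cZ := is_derive_cst (Psi_unit w) s 1.
have H := is_derive_pair (is_derive_turn F cX cZ)
  (is_derive_scale_cst n (is_derive_turn_perp F cX cZ)).
apply: (is_derive_eq (is_derive_ext _ H)) => //.
rewrite /delaunay_X (surjective_pairing (rotation w s)).
rewrite rotation_inner // -n2 /rotation /= -/n.
congr (_, _); apply: vec4_eqP => [|i] /=; rewrite ?mxE /GRing.scale /=; field;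
  by rewrite gt_eqF.
Qed.

(** Uniqueness for the Delaunay field, up to a change of time [tau].  The norm
    of the momentum is conserved, so rotating the curve back by its own angle
    gives a constant pair; no Lipschitz estimate is involved. *)
Lemma delaunay_reparam (J : set R) (c : R -> phase R) (tau m : R -> R) a t :
  open J -> is_interval J ->
  (forall t, J t -> [/\ TplusS3 (c t),
     is_derive t (1 : R) c (m t *: delaunay_X gamma (c t)) &
     is_derive t (1 : R) tau (m t)]) ->
  J a -> J t -> c t = rotation (c a) (tau t - tau a).
Proof.
move=> oJ iJ H Ja Jt.
have nE s : J s -> inner (c s).2 (c s).2 = inner (c a).2 (c a).2.
  move=> Js; apply: (interval_cst (f := fun s => inner (c s).2 (c s).2) iJ) => // r Jr.
  have [[[xx xy] y0] D _] := H r Jr.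
  have D2 := is_derive_snd D.
  apply: (is_derive_eq (is_derive_inner D2 D2)).
  rewrite /delaunay_X; move: xy; case: (c r) => x y /= xy.
  by rewrite !innerE (innerC y x) xy; ring.
have [Ta _ _] := H a Ja; have [n0 n2 ya _] := TplusS3_nu Ta.
set n := Num.sqrt _ in n0 n2 ya.
have cD (s : R) : J s -> is_derive s (1 : R) (fun s => (c s).1) (m s *: ((gamma ^+ 2 / n ^+ 4) *: (c s).2)) /\
    is_derive s (1 : R) (fun s => n^-1 *: (c s).2) (n^-1 *: (m s *: (- (gamma ^+ 2 / n ^+ 2) *: (c s).1))).
  move=> Js; have [_ D _] := H s Js; split.
    have := is_derive_fst D; rewrite /delaunay_X; have := nE s Js.
    by case: (c s) => x y /= ->; rewrite -n2 -exprM.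
  apply: is_derive_scale_cst.
  have := is_derive_snd D; rewrite /delaunay_X; have := nE s Js.
  by case: (c s) => x y /= ->; rewrite -n2.
pose th s := gamma ^+ 2 / n ^+ 3 * (tau s - tau a).
have thD s : J s -> is_derive s (1 : R) th (gamma ^+ 2 / n ^+ 3 * m s).
  move=> Js; have [_ _ D] := H s Js; apply: is_derive_mul_cst.
  by have := is_deriveB D (is_derive_cst (tau a) s 1); rewrite subr0.
have th0 : th a = 0 by rewrite /th subrr mulr0.
pose A s := cos (- th s) *: (c s).1 + sin (- th s) *: (n^-1 *: (c s).2).
pose B s := - (sin (- th s) *: (c s).1) + cos (- th s) *: (n^-1 *: (c s).2).
have EA : A t = (c a).1.
  transitivity (A a); last first.
    by rewrite /A th0 oppr0 cos0 sin0 scale1r scale0r addr0.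
  apply: (interval_cst_vec4 (f := A) iJ) => // s Js.
  have [D1 D2] := cD s Js.
  apply: (is_derive_eq (is_derive_turn (is_deriveN (thD s Js)) D1 D2)).
  apply: vec4_eqP => [|i] /=; rewrite ?mxE /GRing.scale /=; field; by rewrite gt_eqF.
have EB : B t = Psi_unit (c a).
  transitivity (B a); last first.
    by rewrite /B th0 oppr0 cos0 sin0 scale1r scale0r oppr0 add0r.
  apply: (interval_cst_vec4 (f := B) iJ) => // s Js.
  have [D1 D2] := cD s Js.
  apply: (is_derive_eq (is_derive_turn_perp (is_deriveN (thD s Js)) D1 D2)).
  apply: vec4_eqP => [|i] /=; rewrite ?mxE /GRing.scale /=; field; by rewrite gt_eqF.
rewrite /rotation -/n -/(th t) -EA -EB /A /B cosN sinN.
have E := cos2Dsin2 (th t).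
rewrite [LHS]surjective_pairing; congr (_, _).
  rewrite -[LHS]scale1r -E.
  by apply: vec4_eqP => [|i] /=; rewrite ?mxE /GRing.scale /=; ring.
rewrite -[LHS]scale1r -E.
by apply: vec4_eqP => [|i] /=; rewrite ?mxE /GRing.scale /=; field; rewrite gt_eqF.
Qed.

End Rotation.

(** * Images of Kepler curves under Phi *)

Section KeplerToDelaunay.
Context {R : realType} (gamma : R) (g0 : 0 < gamma).

Let g1 : gamma != 0. Proof. by rewrite gt_eqF. Qed.

Lemma is_derive_inv (f : R -> R) t df : f t != 0 -> is_derive t (1 : R) f df ->
  is_derive t (1 : R) (fun s => (f s)^-1) (- ((f t) ^+ 2)^-1 * df).
Proof. by move=> f0 F; have := is_deriveV f0 F; rewrite /GRing.scale. Qed.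

Lemma is_derive_sqrt_comp (f : R -> R) t df : 0 < f t -> is_derive t (1 : R) f df ->
  is_derive t (1 : R) (fun s => Num.sqrt (f s)) ((2 * Num.sqrt (f t))^-1 * df).
Proof.
by move=> f0 F; apply: is_derive1_comp => //; exact: is_derive1_sqrt.
Qed.

Section KeplerMotion.
Variables (n : R) (x p : R -> 'rV[R]_3) (r : R -> R) (m t : R).
Hypothesis el : kepler_data gamma n (r t) (x t) (p t).
Hypothesis Dx : is_derive t (1 : R) x (m *: p t).
Hypothesis Dp : is_derive t (1 : R) p (- (m * gamma / r t ^+ 3) *: x t).
Hypothesis Dr : is_derive t (1 : R) r (m * dot (x t) (p t) / r t).

Let n0 : n != 0. Proof. by case: el => h _ _ _; rewrite gt_eqF. Qed.
Let r0 : r t != 0. Proof. by case: el => _ h _ _; rewrite gt_eqF. Qed.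

Lemma is_derive_xp : is_derive t (1 : R) (fun s => dot (x s) (p s))
  (m * (dot (p t) (p t) - gamma / r t)).
Proof.
case: el => _ _ xx pp; apply: (is_derive_eq (is_derive_dot Dx Dp)).
by rewrite !dotE xx; field.
Qed.

Lemma is_derive_pp : is_derive t (1 : R) (fun s => dot (p s) (p s))
  (- (2 * m * gamma / r t ^+ 3) * dot (x t) (p t)).
Proof.
apply: (is_derive_eq (is_derive_dot Dp Dp)).
by rewrite !dotE (dotC (p t) (x t)); field.
Qed.

(** [alpha] and [beta] rotate into each other at the rate
    [m * gamma / (n * r)], that of the eccentric anomaly. *)
Lemma is_derive_ls_alpha :
  is_derive t (1 : R) (fun s => ls_alpha gamma n (r s) (x s) (p s))
    ((m * gamma / (n * r t)) *: ls_beta gamma n (r t) (p t)).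
Proof.
have D1 := is_derive_mul_cst n^-1 is_derive_xp.
have D2 := is_derive_scale_rV (is_derive_inv r0 Dr) Dx.
have D3 := is_derive_scale_rV (is_derive_mul_cst gamma^-1 is_derive_xp) Dp.
have H := is_derive_pair D1 (is_deriveB D2 D3).
case: (el) => _ _ xx pp.
apply: (is_derive_eq (is_derive_ext _ H)) => [s|].
  by rewrite /ls_alpha !fctE (mulrC n^-1) (mulrC gamma^-1).
apply: vec4_eqP => [|i]; rewrite /ls_beta /= ?mxE /GRing.scale /= pp; field;
  by rewrite ?n0 ?r0 ?g1.
Qed.

Lemma is_derive_ls_beta :
  is_derive t (1 : R) (fun s => ls_beta gamma n (r s) (p s))
    (- (m * gamma / (n * r t)) *: ls_alpha gamma n (r t) (x t) (p t)).
Proof.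
have D1 := is_derive_mul_cst gamma^-1 (is_derive_mul Dr is_derive_pp).
have D2 := is_derive_scale_rV (is_derive_mul_cst n^-1 Dr) Dp.
have H := is_derive_pair (is_deriveB D1 (is_derive_cst (1 : R) t 1)) D2.
case: (el) => _ _ xx pp.
apply: (is_derive_eq (is_derive_ext _ H)) => [s|].
  by rewrite /ls_beta !fctE (mulrC n^-1) (mulrC gamma^-1).
apply: vec4_eqP => [|i]; rewrite /ls_alpha /= ?mxE /GRing.scale /= ?pp; field;
  by rewrite ?n0 ?r0 ?g1.
Qed.

End KeplerMotion.

Section KeplerCurve.
Variables (J : set R) (c : R -> phase R).
Hypotheses (oJ : open J) (iJ : is_interval J).
Hypothesis Kc : forall t, J t -> kepler_neg gamma (c t).
Hypothesis Dc : forall t, J t -> is_derive t (1 : R) c (kepler_X gamma (c t)).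

Let m t := ((c t).1.1 ^+ 2)^-1.

Lemma kepler_gnomonic t : J t ->
  is_derive t (1 : R) (fun s => gnomonic (c s)) (m t *: pi_ (c t)).
Proof.
move=> Jt; have [q0 _] := kepler_neg_pos g0 (Kc Jt).
have Dq := is_derive_fst (Dc Jt).
have q1 : (c t).1.1 != 0 by rewrite gt_eqF.
have H := is_derive_scale_rV (is_derive_inv q1 (is_derive_fst Dq)) (is_derive_snd Dq).
apply: (is_derive_eq H); rewrite /m /kepler_X /pi_.
move: q1; case: (c t) => [[a q] [b v]] /= q1.
by apply/rowP => i; rewrite !mxE; field.
Qed.

Lemma kepler_pi t : J t ->
  is_derive t (1 : R) (fun s => pi_ (c s))
    (- (m t * gamma / radius (c t) ^+ 3) *: gnomonic (c t)).
Proof.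
move=> Jt; have [q0 _] := kepler_neg_pos g0 (Kc Jt).
have r0 := radius_gt0 g0 (Kc Jt).
have [[Tc _] _] := Kc Jt.
have Dq := is_derive_fst (Dc Jt); have Dv := is_derive_snd (Dc Jt).
have q1 : (c t).1.1 != 0 by rewrite gt_eqF.
have s0 : norm3 (c t).1.2 != 0.
  by apply: contraTneq r0; rewrite /radius => ->; rewrite mul0r ltxx.
have H := is_deriveB (is_derive_scale_rV (is_derive_fst Dq) (is_derive_snd Dv))
  (is_derive_scale_rV (is_derive_fst Dv) (is_derive_snd Dq)).
apply: (is_derive_eq (is_derive_ext _ H)) => [s|].
  by rewrite /pi_ !fctE; case: (c s) => [[a q] [b v]].
rewrite /m /kepler_X /radius /gnomonic; have := norm3_sqrt Tc.
move: q1 s0; case: (c t) => [[a q] [b v]] /= q1 s0 <-.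
apply/rowP => i; rewrite !mxE /GRing.scale /=; field; by rewrite q1 s0.
Qed.

Lemma kepler_radius t : J t ->
  is_derive t (1 : R) (fun s => radius (c s))
    (m t * dot (gnomonic (c t)) (pi_ (c t)) / radius (c t)).
Proof.
move=> Jt; have D := kepler_gnomonic Jt.
have rE s : J s -> Num.sqrt (dot (gnomonic (c s)) (gnomonic (c s))) = radius (c s).
  move=> /Kc Ks; have [_ r0 -> _] := kepler_neg_data g0 Ks.
  by rewrite sqrtr_sqr gtr0_norm.
have [_ r0 xx _] := kepler_neg_data g0 (Kc Jt).
have xx0 : 0 < dot (gnomonic (c t)) (gnomonic (c t)) by rewrite xx exprn_gt0.
have H := is_derive_sqrt_comp xx0 (is_derive_dot D D).
apply: (is_derive_near oJ Jt rE); apply: (is_derive_eq H).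
rewrite (rE t Jt); move: (gnomonic (c t)) (pi_ (c t)) => x p.
by rewrite dotZL dotZR (dotC p); field; rewrite gt_eqF.
Qed.

Lemma kepler_energy_cst a t : J a -> J t -> energy gamma (c t) = energy gamma (c a).
Proof.
move=> Ja Jt; apply: (interval_cst (f := fun s => energy gamma (c s)) iJ) => // s Js.
have el := kepler_neg_data g0 (Kc Js).
have [_ r0 xx _] := el.
have r1 : radius (c s) != 0 by rewrite gt_eqF.
have H := is_deriveB (is_derive_mul_cst 2^-1 (is_derive_pp (x := fun s => gnomonic (c s)) (p := fun s => pi_ (c s)) (r := fun s => radius (c s)) el (kepler_pi Js)))
  (is_derive_mul_cst gamma (is_derive_inv (f := fun s => radius (c s)) r1 (kepler_radius Js))).
apply: (is_derive_near oJ Js _ (is_derive_eq H _)).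
  by move=> s' Js'; rewrite energy_radius ?(mulrC _ 2^-1) //; exact: Kc.
by field.
Qed.

(** With [k = m * gamma / (n * r)] the rate at which [alpha] and [beta]
    rotate, the angle [phi = alpha_0] grows at the rate [k * beta_0].  The pair
    in [Phi] therefore turns at the rate
    [k * (1 - beta_0) = m * gamma ^+ 2 / n ^+ 3], which is the Delaunay
    frequency times the time change [m]. *)
Lemma kepler_Phi t : J t ->
  is_derive t (1 : R) (fun s => Phi gamma (c s))
    (m t *: delaunay_X gamma (Phi gamma (c t))).
Proof.
move=> Jt; have el := kepler_neg_data g0 (Kc Jt).
have [n0 r0 _ _] := el; set n := nu gamma (c t) in el n0.
have nE s : J s -> nu gamma (c s) = n.
  by move=> Js; rewrite /n /nu (kepler_energy_cst Js Jt).
have r1 : radius (c t) != 0 by rewrite gt_eqF.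
have n1 : n != 0 by rewrite gt_eqF.
have DA := is_derive_ls_alpha (x := fun s => gnomonic (c s)) (p := fun s => pi_ (c s)) (r := fun s => radius (c s)) el
  (kepler_gnomonic Jt) (kepler_pi Jt) (kepler_radius Jt).
have DB := is_derive_ls_beta (x := fun s => gnomonic (c s)) (p := fun s => pi_ (c s)) (r := fun s => radius (c s)) el
  (kepler_pi Jt) (kepler_radius Jt).
have H := is_derive_pair (is_derive_turn (is_derive_fst DA) DB DA)
  (is_derive_scale_cst (- n) (is_derive_turn_perp (is_derive_fst DA) DB DA)).
have b1 := ls_beta1 g0 el.
have [_ ZZ _] := Phi_orthonormal g0 (Kc Jt); rewrite -/n in ZZ.
have YY : inner (Phi gamma (c t)).2 (Phi gamma (c t)).2 = n ^+ 2.
  rewrite -(scalerKV n1 (Phi gamma (c t)).2) innerZl innerZR ZZ; ring.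
have PhiE s : J s -> Phi gamma (c s) =
    (let A := ls_alpha gamma n (radius (c s)) (gnomonic (c s)) (pi_ (c s)) in
     let B := ls_beta gamma n (radius (c s)) (pi_ (c s)) in
     (cos A.1 *: B + sin A.1 *: A, - n *: (- (sin A.1 *: B) + cos A.1 *: A))).
  move=> Js; rewrite /Phi phiE (alphaE g0 (Kc Js)) (betaE g0 (Kc Js)) (nE s Js).
  congr (_, _); first by rewrite addrC.
  by rewrite scaleNr -scalerN opprD opprK addrC.
apply: (is_derive_near oJ Jt _ (is_derive_eq H _)).
  by move=> s Js; rewrite PhiE.
move: YY b1; rewrite (PhiE t Jt); cbv beta zeta.
move: (ls_alpha _ _ _ _ _) (ls_beta _ _ _ _) => A B; rewrite /delaunay_X => -> b1.
rewrite /= b1; congr (_, _); apply: vec4_eqP => [|i]; rewrite /= ?mxE /GRing.scale /=; field;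
  by rewrite ?n1 ?r1.
Qed.

End KeplerCurve.
End KeplerToDelaunay.

(** * Images of Delaunay curves under the inverse of Phi *)

Section DelaunayToKepler.
Context {R : realType} (gamma : R) (g0 : 0 < gamma).

Lemma kepler_XE (a b : R) (q v : 'rV[R]_3) (d := Num.sqrt (1 - a ^+ 2) ^+ 3)
    (l := inner (b, v) (b, v) + gamma * (a / d)) :
  kepler_X gamma ((a, q), (b, v)) = ((b, v), (gamma / d - l * a, - (l *: q))).
Proof.
rewrite /kepler_X -/d -/l; congr (_, _); apply: vec4_eqP => [|i] /=.
  by rewrite -[in RHS](mulr1 (gamma / d)).
by rewrite !mxE mulr0 add0r.
Qed.

Section Lift.
Variables (n : R) (x p : R -> 'rV[R]_3) (r : R -> R) (t : R).
Hypothesis el : kepler_data gamma n (r t) (x t) (p t).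
Hypothesis Dx : is_derive t (1 : R) x (p t).
Hypothesis Dp : is_derive t (1 : R) p (- (gamma / r t ^+ 3) *: x t).
Hypothesis Dr : is_derive t (1 : R) r (dot (x t) (p t) / r t).

Let state s := lift_state (r s) (dot (x s) (p s)) (x s) (p s).

(** Central projection backwards: a Euclidean Kepler motion is carried to a
    Kepler motion on the sphere, slowed down by [q_0 ^+ 2]. *)
Lemma is_derive_lift :
  is_derive t (1 : R) state ((state t).1.1 ^+ 2 *: kepler_X gamma (state t)).
Proof.
case: (el) => n0 r0 xx pp.
have rn : r t != 0 by rewrite gt_eqF.
have h : 0 < 1 + r t * r t by rewrite ltr_pwDl // mulr_ge0 // ltW.
have Dx' : is_derive t (1 : R) x (1 *: p t) by rewrite scale1r.
have Dp' : is_derive t (1 : R) p (- (1 * gamma / r t ^+ 3) *: x t) by rewrite mul1r.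
have Du := is_derive_xp (m := 1) el Dx' Dp'; rewrite mul1r in Du.
have DS := is_derive_sqrt_comp (f := fun s => 1 + r s * r s) h
  (is_deriveD (is_derive_cst (1 : R) t 1) (is_derive_mul Dr Dr)).
have S0 : Num.sqrt (1 + r t * r t) != 0 by rewrite gt_eqF // sqrtr_gt0.
have Dk := is_derive_inv (f := fun s => Num.sqrt (1 + r s * r s)) S0 DS.
have S0' := invr_neq0 S0.
have Duk := is_derive_mul Du Dk.
have H := is_derive_pair (is_derive_pair Dk (is_derive_scale_rV Dk Dx))
  (is_derive_pair (is_deriveN Duk)
     (is_deriveB (is_derive_scale_rV (is_derive_inv (f := fun s => (Num.sqrt (1 + r s * r s))^-1) S0' Dk) Dp) (is_derive_scale_rV Duk Dx))).
have E s : Num.sqrt (1 + r s * r s) = Num.sqrt (1 + r s ^+ 2) by rewrite expr2.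
apply: (is_derive_eq (is_derive_ext _ H)) => [s|].
  by rewrite /state /lift_state -E.
have S2 : Num.sqrt (1 + r t * r t) ^+ 2 = 1 + r t * r t by rewrite sqr_sqrtr // ltW.
rewrite /state /lift_state -E.
have : 0 < Num.sqrt (1 + r t * r t) by rewrite sqrtr_gt0.
move: S0 S2; set S := Num.sqrt _ => S0 S2 Sp.
set u := dot (x t) (p t).
(* With q_0 = 1 / S the distance to the axis is |q| = r / S. *)
have kr : Num.sqrt (1 - S^-1 ^+ 2) = S^-1 * r t.
  rewrite (_ : 1 - _ = (S^-1 * r t) ^+ 2); last first.
    by rewrite exprMn exprVn (_ : r t ^+ 2 = S ^+ 2 - 1); [field|rewrite S2; ring].
  by rewrite sqrtr_sqr ger0_norm // mulr_ge0 // ?invr_ge0 ltW.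
have vv : inner (- (u * S^-1), S^-1^-1 *: p t - (u * S^-1) *: x t)
    (- (u * S^-1), S^-1^-1 *: p t - (u * S^-1) *: x t) =
    S ^+ 2 * dot (p t) (p t) - u ^+ 2.
  rewrite /inner /= invrK !dotE (dotC (p t)) xx -/u.
  rewrite (_ : r t ^+ 2 = S ^+ 2 - 1); last by rewrite S2; ring.
  by field.
rewrite kepler_XE vv kr.
move: (dot (p t) (p t)) => P.
have rE : r t ^+ 2 = S ^+ 2 - 1 by rewrite S2; ring.
congr (_, _).
  congr (_, _); first by rewrite /GRing.scale /=; field; rewrite rn S0.
  by apply/rowP => i; rewrite !mxE /=; field; rewrite rn S0.
congr (_, _); first rewrite /GRing.scale /=.
  transitivity (u ^+ 2 / S ^+ 3 - P / S + gamma * r t ^+ 2 / (S * r t ^+ 3)).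
    by field; rewrite rn S0.
  by rewrite rE; field; rewrite rn S0.
apply/rowP => i; rewrite !mxE /=.
transitivity ((u ^+ 2 / S ^+ 3 - P / S + gamma * r t ^+ 2 / (S * r t ^+ 3) -
  gamma * S / r t ^+ 3) * x t 0 i); first by field; rewrite rn S0.
by rewrite rE; field; rewrite rn S0.
Qed.

End Lift.
End DelaunayToKepler.

Section RotationLift.
Context {R : realType} (gamma : R) (g0 : 0 < gamma).

Let g1 : gamma != 0. Proof. by rewrite gt_eqF. Qed.

Variables (w : phase R) (J : set R).
Hypotheses (oJ : open J) (Tw : TplusS3 w).
Hypothesis DJ : forall s, J s -> delaunay_domain (rotation gamma w s).

Let n := Num.sqrt (inner w.2 w.2).
Let omega := gamma ^+ 2 / n ^+ 3.
Let W s := rotation gamma w s.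
Let X s := (W s).1.
Let Z s := Psi_unit (W s).

Lemma Ck_rotation k : Ck k setT (rotation gamma w).
Proof.
have cth : Ck k setT (fun s : R => omega * s).
  by apply: (Ck_mul openT (Ck_cst _ _ _)); exact: Ck_id.
have cc := Ck_cosf openT cth; have cs := Ck_sinf openT cth.
apply: (Ck_pair openT).
  by apply: (Ck_add openT); exact: Ck_scale_cst openT _.
apply: (Ck_scale_vec4 openT (Ck_cst _ _ _)).
apply: (Ck_add openT); last exact: Ck_scale_cst openT _.
by apply: (Ck_opp openT); exact: Ck_scale_cst openT _.
Qed.

Let nn : [/\ 0 < n, n != 0, n ^+ 2 = inner w.2 w.2 &
  forall s, Num.sqrt (inner (W s).2 (W s).2) = n].
Proof.
have [n0 n2 _ _] := TplusS3_nu Tw; split=> //; first by rewrite gt_eqF.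
by move=> s; rewrite /W rotation_inner.
Qed.

Lemma Psi_unit_rotation s : Z s = n^-1 *: (W s).2.
Proof. by rewrite /Z /W rotation_unit. Qed.

Lemma is_derive_X s : is_derive s (1 : R) X (omega *: Z s).
Proof.
have [n0 n1 n2 _] := nn; have := is_derive_fst (rotation_derive gamma s Tw).
rewrite Psi_unit_rotation scalerA /delaunay_X -/(W s).
have : inner (W s).2 (W s).2 = n ^+ 2 by rewrite n2 /W rotation_inner.
case: (W s) => x y /= -> D; apply: (is_derive_eq D).
by congr (_ *: _); rewrite /omega; field.
Qed.

Lemma is_derive_Z s : is_derive s (1 : R) Z (- omega *: X s).
Proof.
have [n0 n1 n2 _] := nn.
have := is_derive_scale_cst n^-1 (is_derive_snd (rotation_derive gamma s Tw)).
rewrite /delaunay_X -/(W s).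
have : inner (W s).2 (W s).2 = n ^+ 2 by rewrite n2 /W rotation_inner.
move=> E D; apply: (is_derive_eq (is_derive_ext _ D)) => [r|].
  by rewrite Psi_unit_rotation.
rewrite /X; move: E; case: (W s) => x y /= ->.
by rewrite scalerA; congr (_ *: _); rewrite /omega; field.
Qed.

Lemma Ck_Psi_phi_rotation k : Ck k J (fun s => Psi_phi (W s)).
Proof.
have Ckn k' : Ck k' J (fun s => W s).
  exact: Ck_subset (@subsetT _ J) (Ck_rotation k').
apply: (Ck_kepler_sol oJ) => [k'|k'|s Js|s Js].
- by do 2 apply: (Ck_fst oJ); exact: Ckn.
- apply: (Ck_fst oJ); apply: (Ck_eq oJ (f := fun s => n^-1 *: (W s).2)).
    by move=> s _; rewrite -Psi_unit_rotation.
  by apply: (Ck_scale_vec4 oJ (Ck_cst _ _ _)); apply: (Ck_snd oJ); exact: Ckn.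
- exact: delaunay_le1 (DJ Js).
- exact: delaunay_neq1 (DJ Js).
Qed.

(** The pair turns at the rate [omega + D], where [D] is the still unknown
    derivative of the solution of Kepler's equation.  Since that solution is
    the first coordinate of [Psi_alpha], its derivative is also
    [(omega + D) * beta_0]; this linear equation determines [D]. *)
Lemma is_derive_Psi_alpha_beta s (k := gamma / (n * Psi_radius gamma (W s))) : J s ->
  is_derive s (1 : R) (fun s => Psi_alpha (W s)) (k *: Psi_beta (W s)) /\
  is_derive s (1 : R) (fun s => Psi_beta (W s)) (- k *: Psi_alpha (W s)).
Proof.
move=> Js; have [n0 n1 n2 nW] := nn; have Ds := DJ Js.
have [D Df] : exists D, is_derive s (1 : R) (fun s => Psi_phi (W s)) D.
  have [/(_ s Js)/derivable1_diffP/derivableP Df _] := Ck_Psi_phi_rotation 1%N.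
  by eexists; exact: Df.
have DB := is_derive_turn Df (is_derive_X s) (is_derive_Z s).
have DA := is_deriveN (is_derive_turn_perp Df (is_derive_X s) (is_derive_Z s)).
have {}DB : is_derive s (1 : R) (fun s => Psi_beta (W s)) (- (omega + D) *: Psi_alpha (W s)).
  apply: (is_derive_eq DB); rewrite /Psi_alpha -/(X s) -/(Z s).
  by apply: vec4_eqP => [|i] /=; rewrite ?mxE /GRing.scale /=; ring.
have {}DA : is_derive s (1 : R) (fun s => Psi_alpha (W s)) ((omega + D) *: Psi_beta (W s)).
  apply: (is_derive_eq (is_derive_ext _ DA)) => [r|].
    by rewrite /Psi_alpha -/(X r) -/(Z r) !fctE opprD opprK.
  rewrite /Psi_beta -/(X s) -/(Z s).
  by apply: vec4_eqP => [|i] /=; rewrite ?mxE /GRing.scale /=; ring.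
suff -> : k = omega + D by [].
(* Two expressions for the derivative of the first coordinate of alpha. *)
have ED : D = (omega + D) * (Psi_beta (W s)).1.
  have D1 : is_derive s (1 : R) (fun s => Psi_phi (W s)) ((omega + D) * (Psi_beta (W s)).1).
    apply: (is_derive_near oJ Js _ (is_derive_fst DA)) => r Jr.
    by rewrite Psi_alpha1 //; exact: DJ.
  by case: Df D1 => _ <- [_ <-].
have b0 := Psi_beta1 Ds; have bE := Psi_radiusE g0 Ds; rewrite nW in bE.
have r0 := Psi_radius_gt0 g0 Ds.
have : (omega + D) * (1 - (Psi_beta (W s)).1) = omega.
  by rewrite mulrBr mulr1 -ED addrK.
rewrite bE => E.
have -> : omega + D = (omega + D) * (1 - (1 - gamma * Psi_radius gamma (W s) / n ^+ 2)) *
   (n ^+ 2 / (gamma * Psi_radius gamma (W s))).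
  by field; rewrite g1 n1 gt_eqF.
by rewrite E /k /omega; field; rewrite g1 n1 gt_eqF.
Qed.

(** The reconstructed position, momentum and radius satisfy the equations of
    the Euclidean Kepler problem in the Delaunay time. *)
Lemma is_derive_Psi s : J s ->
  is_derive s (1 : R) (fun s => Psi gamma (W s))
    ((Psi gamma (W s)).1.1 ^+ 2 *: kepler_X gamma (Psi gamma (W s))).
Proof.
move=> Js; have [n0 n1 n2 nW] := nn; have Ds := DJ Js.
have [DA DB] := is_derive_Psi_alpha_beta Js.
have el := Psi_data g0 Ds; have r0 := Psi_radius_gt0 g0 Ds.
have rn : Psi_radius gamma (W s) != 0 by rewrite gt_eqF.
rewrite nW in el.
have iW r : inner (W r).2 (W r).2 = n ^+ 2 by rewrite n2 /W rotation_inner.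
have a1 := Psi_alpha1 Ds.
have Dr : is_derive s (1 : R) (fun s => Psi_radius gamma (W s))
    (dot (Psi_gnomonic gamma (W s)) (Psi_pi gamma (W s)) / Psi_radius gamma (W s)).
  have H := is_derive_mul_cst (n ^+ 2 / gamma)
     (is_deriveB (is_derive_cst (1 : R) s 1) (is_derive_fst DB)).
  apply: (is_derive_eq (is_derive_ext _ H)) => [r|].
    by rewrite /Psi_radius iW !fctE mulrAC.
  rewrite (Psi_dot g0 Ds) nW -a1.
  move: (Psi_alpha (W s)) (Psi_radius _ _) rn => A r rn; rewrite /= /GRing.scale /=.
  by field; rewrite g1 n1 rn.
have bE := Psi_radiusE g0 Ds; rewrite nW in bE.
have Dp : is_derive s (1 : R) (fun s => Psi_pi gamma (W s))
    (- (gamma / Psi_radius gamma (W s) ^+ 3) *: Psi_gnomonic gamma (W s)).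
  have H := is_derive_scale_rV (is_derive_mul_cst n
      (is_derive_inv (f := fun s => Psi_radius gamma (W s)) rn Dr)) (is_derive_snd DB).
  apply: (is_derive_eq (is_derive_ext _ H)) => [r|].
    by rewrite /Psi_pi nW.
  rewrite (Psi_dot g0 Ds) nW /Psi_gnomonic iW.
  move: (Psi_alpha (W s)) (Psi_beta (W s)) (Psi_phi _) (Psi_radius _ _) rn => A B f r rn.
  apply/rowP => i; rewrite !mxE /=. by field; rewrite g1 n1 rn.
have Dphi : is_derive s (1 : R) (fun s => Psi_phi (W s))
    (gamma / (n * Psi_radius gamma (W s)) * (Psi_beta (W s)).1).
  apply: (is_derive_near oJ Js _ (is_derive_fst DA)) => r Jr.
  by rewrite Psi_alpha1 //; exact: DJ.
have Dx : is_derive s (1 : R) (fun s => Psi_gnomonic gamma (W s)) (Psi_pi gamma (W s)).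
  have H := is_deriveD (is_derive_scale_rV Dr (is_derive_snd DA))
    (is_derive_scale_rV (is_derive_mul_cst (n ^+ 2 / gamma) Dphi) (is_derive_snd DB)).
  apply: (is_derive_eq (is_derive_ext _ H)) => [r|].
    by rewrite /Psi_gnomonic iW !fctE mulrAC.
  rewrite (Psi_dot g0 Ds) nW /Psi_pi nW bE.
  move: (Psi_alpha (W s)) (Psi_beta (W s)) (Psi_phi _) (Psi_radius _ _) rn => A B f r rn.
  apply/rowP => i; rewrite !mxE /=. by field; rewrite g1 n1 rn.
have H := is_derive_lift (x := fun s => Psi_gnomonic gamma (W s))
  (p := fun s => Psi_pi gamma (W s)) (r := fun s => Psi_radius gamma (W s)) el Dx Dp Dr.
have PE r : J r -> lift_state (Psi_radius gamma (W r))
    (dot (Psi_gnomonic gamma (W r)) (Psi_pi gamma (W r)))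
    (Psi_gnomonic gamma (W r)) (Psi_pi gamma (W r)) = Psi gamma (W r).
  by move=> Jr; rewrite (Psi_dot g0 (DJ Jr)).
rewrite (PE _ Js) in H.
by apply: (is_derive_near oJ Js _ H).
Qed.

End RotationLift.

(** * Phi is a diffeomorphism *)

Section SmoothMaps.
Context {R : realType} (gamma : R) (g0 : 0 < gamma).

Let g1 : gamma != 0. Proof. by rewrite gt_eqF. Qed.

Section SmoothPhi.
Let U0 : set (phase R) :=
  setT `&` [set z | 0 < z.1.1] `&` [set z | 0 < 1 - z.1.1 ^+ 2] `&`
    [set z | 0 < dot z.1.2 z.1.2].
Let U : set (phase R) := U0 `&` [set z | 0 < - energy gamma z].

Section Coordinates.
Context (k : nat) (S : set (phase R)) (oS : open S).
Lemma Ck_q : Ck k S (fun z => z.1). Proof. exact: (Ck_fst oS (Ck_id _ _)). Qed.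
Lemma Ck_v : Ck k S (fun z => z.2). Proof. exact: (Ck_snd oS (Ck_id _ _)). Qed.
Lemma Ck_q0 : Ck k S (fun z => z.1.1). Proof. exact: (Ck_fst oS Ck_q). Qed.
Lemma Ck_qv : Ck k S (fun z => z.1.2). Proof. exact: (Ck_snd oS Ck_q). Qed.
Lemma Ck_v0 : Ck k S (fun z => z.2.1). Proof. exact: (Ck_fst oS Ck_v). Qed.
Lemma Ck_vv : Ck k S (fun z => z.2.2). Proof. exact: (Ck_snd oS Ck_v). Qed.
Lemma Ck_pole : Ck k S (fun z => 1 - z.1.1 ^+ 2).
Proof. exact: (Ck_sub oS (Ck_cst _ _ _) (Ck_expf oS 2 Ck_q0)). Qed.
Lemma Ck_pi : Ck k S (@pi_ R).
Proof.
apply: (Ck_eq oS (f := fun z : phase R => z.1.1 *: z.2.2 - z.2.1 *: z.1.2)).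
  by move=> [[a q] [b v]].
by apply: (Ck_sub oS); apply: (Ck_scale_rV oS);
  [exact: Ck_q0|exact: Ck_vv|exact: Ck_v0|exact: Ck_qv].
Qed.
End Coordinates.

Let oU0 : open U0.
Proof.
have o1 := open_Ck_pos openT (Ck_q0 0 openT).
have o2 := open_Ck_pos o1 (Ck_pole 0 o1).
exact: (open_Ck_pos o2 (Ck_dot o2 (Ck_qv 0 o2) (Ck_qv 0 o2))).
Qed.

Let Ck_energy k : Ck k U0 (energy gamma).
Proof.
apply: (Ck_eq oU0 (f := fun z : phase R => inner z.2 z.2 / 2 -
  gamma * (z.1.1 / Num.sqrt (1 - z.1.1 ^+ 2)) - dot (mu z) (mu z) / 2)).
  by move=> [q v].
have cmu : Ck k U0 (@mu R) by apply: (Ck_cross oU0); [exact: Ck_qv|exact: Ck_vv].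
have chalf : Ck k U0 (fun=> 2^-1 : R) by exact: Ck_cst.
apply: (Ck_sub oU0); last exact: (Ck_mul oU0 (Ck_dot oU0 cmu cmu) chalf).
apply: (Ck_sub oU0).
  exact: (Ck_mul oU0 (Ck_inner oU0 (Ck_v _ oU0) (Ck_v _ oU0)) chalf).
apply: (Ck_mul oU0 (Ck_cst _ _ _)); apply: (Ck_div oU0); last 2 first.
- exact: Ck_q0.
- by apply: (Ck_sqrtf oU0) (Ck_pole _ oU0) => z [[_ h] _].
- by move=> z [[_ h] _]; rewrite gt_eqF // sqrtr_gt0.
Qed.

Let oU : open U.
Proof. exact: (open_Ck_pos oU0 (Ck_opp oU0 (Ck_energy 0))). Qed.

Lemma Ck_Phi k : Ck k U (Phi gamma).
Proof.
have UU0 : U `<=` U0 by move=> z [].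
have ce : Ck k U (energy gamma) := Ck_subset UU0 (Ck_energy k).
have cp := Ck_pi k oU; have cq0 := Ck_q0 k oU; have cqv := Ck_qv k oU.
have ccst (a : R) : Ck k U (fun=> a) by exact: Ck_cst.
have q0n z : U z -> z.1.1 != 0 by move=> [[[[_ h] _] _] _]; rewrite gt_eqF.
have e0 z : U z -> 0 < - 2 * energy gamma z by move=> [_ h]; rewrite /= in h; lra.
have cnu : Ck k U (nu gamma).
  apply: (Ck_div oU) (ccst _) _.
    by move=> z /e0 h; rewrite gt_eqF // sqrtr_gt0.
  by apply: (Ck_sqrtf oU e0); exact: (Ck_mul oU (ccst _) ce).
have nu0 z : U z -> nu gamma z != 0.
  by move=> /e0 h; rewrite gt_eqF // divr_gt0 // sqrtr_gt0.
have cnorm : Ck k U (fun z => norm3 z.1.2).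
  by apply: (Ck_sqrtf oU) (Ck_dot oU cqv cqv) => z [[_ h] _].
have norm0 z : U z -> norm3 z.1.2 != 0.
  by move=> [[_ h] _]; rewrite gt_eqF // sqrtr_gt0.
have cqp : Ck k U (fun z => dot z.1.2 (pi_ z)) := Ck_dot oU cqv cp.
have cphi : Ck k U (phi gamma).
  apply: (Ck_mul oU) cqp; apply: (Ck_invf oU) (Ck_mul oU cnu cq0) => z Uz.
  by rewrite mulf_neq0 ?nu0 ?q0n.
have cgq : Ck k U (fun z => gamma * z.1.1) := Ck_mul oU (ccst gamma) cq0.
have gq0 z : U z -> gamma * z.1.1 != 0 by move=> Uz; rewrite mulf_neq0 ?q0n.
have ca : Ck k U (alpha gamma).
  apply: (Ck_pair oU) cphi _; apply: (Ck_sub oU).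
    exact: (Ck_scale_rV oU (Ck_invf oU norm0 cnorm) cqv).
  exact: (Ck_scale_rV oU (Ck_div oU gq0 cqp cgq) cp).
have cb : Ck k U (beta gamma).
  apply: (Ck_pair oU).
    apply: (Ck_sub oU) (ccst 1); apply: (Ck_mul oU) (Ck_dot oU cp cp).
    exact: (Ck_div oU gq0 cnorm cgq).
  apply: (Ck_scale_rV oU) cp; apply: (Ck_div oU) cnorm (Ck_mul oU cnu cq0) => z Uz.
  by rewrite mulf_neq0 ?nu0 ?q0n.
have cs := Ck_sinf oU cphi; have cc := Ck_cosf oU cphi.
apply: (Ck_pair oU).
  by apply: (Ck_add oU); exact: Ck_scale_vec4.
apply: (Ck_scale_vec4 oU cnu); apply: (Ck_add oU); last exact: Ck_scale_vec4.
by apply: (Ck_opp oU); exact: Ck_scale_vec4.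
Qed.

Lemma smooth_Phi : smooth_map (kepler_neg gamma) (Phi gamma).
Proof.
move=> z Kz; exists U, (Phi gamma); split=> //; last exact: Ck_Phi.
split=> //; have [q0 q1] := kepler_neg_pos g0 Kz; have [[Tz _] E] := Kz.
split; last by rewrite /= oppr_gt0.
have q2 : 0 < 1 - z.1.1 ^+ 2 by rewrite subr_gt0.
by split; [split|rewrite /= (TS3_dot Tz).1].
Qed.

End SmoothPhi.

Section SmoothPsi.

(** Stated for a smooth map [f] into the Delaunay domain rather than on an open
    set, since Kepler's equation is controlled only on the submanifold itself;
    used with a retraction onto it and with orbits inside it. *)
Lemma Ck_Psi (V : normedModType R) (S : set V) (f : V -> phase R) : open S ->
  (forall x, S x -> delaunay_domain (f x)) -> (forall k, Ck k S f) ->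
  forall k, Ck k S (fun x => Psi gamma (f x)).
Proof.
move=> oS Sf cf k.
have cX j : Ck j S (fun x => (f x).1) := Ck_fst oS (cf j).
have cY j : Ck j S (fun x => (f x).2) := Ck_snd oS (cf j).
have cYY j : Ck j S (fun x => inner (f x).2 (f x).2) := Ck_inner oS (cY j) (cY j).
have YY x : S x -> 0 < inner (f x).2 (f x).2 by move=> /Sf [[_ h] _]; exact: inner_gt0.
have cn j : Ck j S (fun x => Num.sqrt (inner (f x).2 (f x).2)) := Ck_sqrtf oS YY (cYY j).
have n0 x : S x -> Num.sqrt (inner (f x).2 (f x).2) != 0.
  by move=> /YY h; rewrite gt_eqF // sqrtr_gt0.
have cZ j : Ck j S (fun x => Psi_unit (f x)) := Ck_scale_vec4 oS (Ck_invf oS (n0) (cn j)) (cY j).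
have cphi : Ck k S (fun x => Psi_phi (f x)).
  apply: (Ck_kepler_sol oS) => [j|j|x Sx|x Sx].
  - exact: (Ck_fst oS (cX j)).
  - exact: (Ck_fst oS (cZ j)).
  - exact: delaunay_le1 (Sf _ Sx).
  - exact: delaunay_neq1 (Sf _ Sx).
have cs := Ck_sinf oS cphi; have cc := Ck_cosf oS cphi.
have ca : Ck k S (fun x => Psi_alpha (f x)).
  exact: (Ck_sub oS (Ck_scale_vec4 oS cs (cX k)) (Ck_scale_vec4 oS cc (cZ k))).
have cb : Ck k S (fun x => Psi_beta (f x)).
  exact: (Ck_add oS (Ck_scale_vec4 oS cc (cX k)) (Ck_scale_vec4 oS cs (cZ k))).
have ccst (a : R) : Ck k S (fun=> a) by exact: Ck_cst.
have cr : Ck k S (fun x => Psi_radius gamma (f x)).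
  apply: (Ck_mul oS) (ccst _); apply: (Ck_mul oS (cYY k)).
  exact: (Ck_sub oS (ccst _) (Ck_fst oS cb)).
have r0 x : S x -> Psi_radius gamma (f x) != 0.
  by move=> Sx; rewrite gt_eqF // Psi_radius_gt0 //; exact: Sf.
have cp : Ck k S (fun x => Psi_pi gamma (f x)).
  exact: (Ck_scale_rV oS (Ck_div oS r0 (cn k) cr) (Ck_snd oS cb)).
have cx : Ck k S (fun x => Psi_gnomonic gamma (f x)).
  apply: (Ck_add oS); apply: (Ck_scale_rV oS) => //; try exact: Ck_snd.
  exact: (Ck_mul oS (Ck_mul oS (cYY k) cphi) (ccst _)).
have cu : Ck k S (fun x => Num.sqrt (inner (f x).2 (f x).2) * Psi_phi (f x)).
  exact: (Ck_mul oS (cn k) cphi).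
have pos x : S x -> 0 < 1 + Psi_radius gamma (f x) ^+ 2.
  by move=> _; rewrite ltr_pwDl // sqr_ge0.
have cS : Ck k S (fun x => Num.sqrt (1 + Psi_radius gamma (f x) ^+ 2)).
  by apply: (Ck_sqrtf oS pos); exact: (Ck_add oS (ccst _) (Ck_expf oS 2 cr)).
have S0 x : S x -> Num.sqrt (1 + Psi_radius gamma (f x) ^+ 2) != 0.
  by move=> /pos h; rewrite gt_eqF // sqrtr_gt0.
have ck := Ck_invf oS S0 cS.
have ckk := Ck_invf oS (fun x Sx => invr_neq0 (S0 x Sx)) ck.
have cuk := Ck_mul oS cu ck.
apply: (Ck_pair oS); apply: (Ck_pair oS) => //.
- exact: Ck_scale_rV.
- exact: Ck_opp.
- exact: (Ck_sub oS (Ck_scale_rV oS ckk cp) (Ck_scale_rV oS cuk cx)).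
Qed.

Let proj1 (w : phase R) : vec4 R := (Num.sqrt (inner w.1 w.1))^-1 *: w.1.
Let proj2 (w : phase R) : vec4 R := w.2 - inner w.2 (proj1 w) *: proj1 w.

Let D1 : set (phase R) := setT `&` [set w | 0 < inner w.1 w.1].
Let D : set (phase R) := D1 `&` [set w | 0 < inner (proj2 w) (proj2 w)]
  `&` [set w | 0 < inner (proj1 w - e0 R) (proj1 w - e0 R)].

Let oD1 : open D1.
Proof. exact: (open_Ck_pos openT (Ck_inner openT (Ck_q 0 openT) (Ck_q 0 openT))). Qed.

Let Ck_proj1 k : Ck k D1 proj1.
Proof.
have c := Ck_q k oD1; apply: (Ck_scale_vec4 oD1) (c); apply: (Ck_invf oD1).
  by move=> w [_ h]; rewrite gt_eqF // sqrtr_gt0.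
by apply: (Ck_sqrtf oD1) (Ck_inner oD1 c c) => w [].
Qed.

Let Ck_proj2 k : Ck k D1 proj2.
Proof.
have c := Ck_v k oD1; have c1 := Ck_proj1 k; apply: (Ck_sub oD1 c).
exact: (Ck_scale_vec4 oD1 (Ck_inner oD1 c c1) c1).
Qed.

Let oD : open D.
Proof.
have o2 := open_Ck_pos oD1 (Ck_inner oD1 (Ck_proj2 0) (Ck_proj2 0)).
have c : Ck 0 (D1 `&` [set w | 0 < inner (proj2 w) (proj2 w)]) (fun w => proj1 w - e0 R).
  apply: (Ck_sub o2); last exact: Ck_cst.
  by apply: (Ck_subset _ (Ck_proj1 0)) => w [].
exact: (open_Ck_pos o2 (Ck_inner o2 c c)).
Qed.

Let proj_domain w : D w -> delaunay_domain (proj1 w, proj2 w).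
Proof.
move=> [[[_ XX] YY] EE]; rewrite /= in XX YY EE.
have P1 : inner (proj1 w) (proj1 w) = 1.
  have s2 := sqr_sqrtr (ltW XX); rewrite /proj1 innerZl innerZR.
  rewrite -{3}s2; field; by rewrite gt_eqF // sqrtr_gt0.
have P2 : inner (proj1 w) (proj2 w) = 0.
  by rewrite /proj2 innerDR innerNR innerZR P1 mulr1 (innerC w.2) subrr.
have i0 : inner (0 : vec4 R) 0 = 0 by rewrite -(scale0r 0) innerZl mul0r.
split; last by apply/eqP => /= E; move: EE; rewrite E subrr i0 ltxx.
by split=> //; apply/eqP => /= E; move: YY; rewrite E i0 ltxx.
Qed.

(** The ambient extension is [Psi] after the Gram-Schmidt retraction onto
    [TS3]. *)
Lemma smooth_Psi : smooth_map (@delaunay_domain R) (Psi gamma).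
Proof.
move=> w0 Dw0; exists D, (fun w => Psi gamma (proj1 w, proj2 w)).
have DD1 : D `<=` D1 by move=> w [[]].
have projE w : delaunay_domain w -> proj1 w = w.1 /\ proj2 w = w.2.
  move=> [[[xx xy] _] _].
  have e : proj1 w = w.1 by rewrite /proj1 xx sqrtr1 invr1 scale1r.
  by split=> //; rewrite /proj2 e innerC xy scale0r subr0.
split.
- split=> //; have [e1 e2] := projE _ Dw0; have [[[xx xy] y0] x0] := Dw0.
  split; last by rewrite /= e1; apply: inner_gt0; rewrite subr_eq0.
  by split; [split=> //=; rewrite xx|rewrite /= e2; exact: inner_gt0].
- apply: (Ck_Psi oD proj_domain) => k; apply: (Ck_pair oD).
    exact: Ck_subset DD1 (Ck_proj1 k).
  exact: Ck_subset DD1 (Ck_proj2 k).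
- by move=> w Dw _; have [-> ->] := projE _ Dw; case: (w).
Qed.

Lemma Phi_diffeomorphism :
  diffeomorphism (kepler_neg gamma) (@delaunay_domain R) (Phi gamma).
Proof.
split; [exact: Phi_bij|exact: smooth_Phi|].
by exists (Psi gamma); split; [move=> z; exact: PhiK|exact: smooth_Psi].
Qed.

End SmoothPsi.
End SmoothMaps.

(** * Change of time *)

Section TimeChange.
Context {R : realType} (J : set R) (oJ : open J) (iJ : is_interval J) (J0 : J 0).
Variable f : R -> R.
Hypothesis f_pos : forall s, J s -> 0 < f s.
Hypothesis f_cont : forall s, J s -> {for s, continuous f}.

(** The time on the Kepler side as a function of the time on the Delaunay
    side; [f] will be [q_0 ^+ 2]. *)
Definition clock (s : R) : R := oriented_integral 0 s f.
Definition clock_inv (t : R) : R := xget 0 [set s | J s /\ clock s = t].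

Lemma clock_derive s : J s -> is_derive s (1 : R) clock (f s).
Proof. by move=> Js; exact: (is_derive_oriented_integral oJ iJ). Qed.

Lemma clock0 : clock 0 = 0.
Proof. exact: oriented_integralxx. Qed.

Lemma clock_lt s s' : J s -> J s' -> s < s' -> clock s < clock s'.
Proof. exact: (interval_incr iJ clock_derive f_pos). Qed.

Lemma clock_inj s s' : J s -> J s' -> clock s = clock s' -> s = s'.
Proof.
move=> Js Js' E; have [h|h|//] := ltgtP s s'.
  by have := clock_lt Js Js' h; rewrite E ltxx.
by have := clock_lt Js' Js h; rewrite E ltxx.
Qed.

Lemma clock_range : open (clock @` J) /\ is_interval (clock @` J).
Proof. exact: (interval_image oJ iJ clock_derive f_pos). Qed.

Lemma clock_invP t : (clock @` J) t -> J (clock_inv t) /\ clock (clock_inv t) = t.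
Proof.
move=> [s Js st]; exact: (xgetPex 0 (ex_intro (fun s => J s /\ clock s = t) s (conj Js st))).
Qed.

Lemma clockK s : J s -> clock_inv (clock s) = s.
Proof.
by move=> Js; have [|h e] := @clock_invP (clock s); [exists s|exact: clock_inj].
Qed.

Lemma clock_inv_derive t : (clock @` J) t ->
  is_derive t (1 : R) clock_inv (f (clock_inv t))^-1.
Proof.
move=> /clock_invP [Js E]; set s := clock_inv t in Js E *; rewrite -[t]E.
apply: is_derive_inverse.
- by apply: filterS (interval_open_near oJ Js) => r /clockK.
- by apply: filterS (interval_open_near oJ Js) => r Jr; exact: is_derive_cont (clock_derive Jr).
- exact: clock_derive.
- by rewrite gt_eqF // f_pos.
Qed.

Lemma clock_inv_lt t t' : (clock @` J) t -> (clock @` J) t' -> t < t' ->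
  clock_inv t < clock_inv t'.
Proof.
move=> /clock_invP [J1 e1] /clock_invP [J2 e2] tt'; rewrite ltNge le_eqVlt.
apply/negP => /predU1P[h|h]; first by rewrite -e1 -e2 h ltxx in tt'.
by have := clock_lt J2 J1 h; rewrite e1 e2 ltNge ltW.
Qed.

Hypothesis f_smooth : forall k, Ck k J f.

Lemma Ck_clock k : Ck k J clock.
Proof. by apply: CkW; exact: (Ck_derive1 oJ clock_derive). Qed.

(** The derivative of the inverse is [(f (clock_inv t))^-1], so regularity
    bootstraps. *)
Lemma Ck_clock_inv k : Ck k (clock @` J) clock_inv.
Proof.
have [oI _] := clock_range.
elim: k => [|k IH]; first by move=> t It; exact: is_derive_cont (clock_inv_derive It).
apply: (Ck_derive1 oI clock_inv_derive).
have JS t : (clock @` J) t -> J (clock_inv t) by move=> /clock_invP [].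
apply: (Ck_invf oI); first by move=> t /JS h; rewrite gt_eqF // f_pos.
exact: (Ck_comp1 oI JS IH (f_smooth k)).
Qed.

End TimeChange.

(** * The two flows and their equivalence *)

Section Flows.
Context {R : realType} (gamma : R) (g0 : 0 < gamma).
Implicit Types (z w : phase R) (s t : R).

Let i0 : inner (0 : vec4 R) 0 = 0.
Proof. by rewrite -(scale0r 0) innerZl mul0r. Qed.

(** The component of [0] in the set of times at which the great circle stays
    away from the pole.  Orbits through [e0] correspond to collision orbits of
    the Kepler problem, and are cut there. *)
Definition delaunay_time w : set R :=
  [set s | forall r, Num.min 0 s <= r <= Num.max 0 s -> (rotation gamma w r).1 != e0 R].

Section DelaunayFlow.
Variable w : phase R.
Hypothesis Dw : delaunay_domain w.

Let Tw : TplusS3 w. Proof. by case: Dw. Qed.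

Lemma delaunay_timeW s : delaunay_time w s -> delaunay_domain (rotation gamma w s).
Proof.
move=> h; split; first exact: rotation_TplusS3.
by apply: h; rewrite ge_min le_max lexx !orbT.
Qed.

Lemma delaunay_time0 : delaunay_time w 0.
Proof.
move=> r; rewrite min_l // max_l // => h.
have -> : r = 0 by apply: le_anti; rewrite andbC.
by rewrite rotation0 //; case: Dw.
Qed.

Lemma delaunay_time_sub (J : set R) : is_interval J -> J 0 ->
  (forall s, J s -> (rotation gamma w s).1 != e0 R) -> J `<=` delaunay_time w.
Proof.
move=> iJ J0 h s Js r rs; apply: h.
apply: (iJ (Num.min 0 s) (Num.max 0 s)) => //; by case: leP.
Qed.

Lemma delaunay_time_interval : is_interval (delaunay_time w).
Proof.
move=> x y Jx Jy s /andP[xs sy] r /andP[].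
rewrite ge_min le_max => /orP[h1|h1] /orP[h2|h2].
- have -> : r = 0 by apply: le_anti; rewrite h1 h2.
  by apply: delaunay_time0; rewrite ge_min le_max lexx.
- by apply: Jy; rewrite ge_min le_max h1 (le_trans h2 sy) !orbT.
- by apply: Jx; rewrite ge_min le_max h2 (le_trans xs h1) !orbT.
- have -> : r = s by apply: le_anti; rewrite h1 h2.
  have [s0|s0] := leP 0 s.
    by apply: Jy; rewrite ge_min le_max s0 sy orbT.
  by apply: Jx; rewrite ge_min le_max (ltW s0) xs orbT.
Qed.

Lemma open_not_pole : open [set s | (rotation gamma w s).1 != e0 R].
Proof.
have cX : Ck 0 setT (fun s : R => (rotation gamma w s).1 - e0 R).
  apply: (Ck_sub openT); last exact: Ck_cst.
  exact: (Ck_fst openT (Ck_rotation gamma w 0)).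
have := open_Ck_pos openT (Ck_inner openT cX cX).
congr open; apply/seteqP; split=> s /=.
  by move=> [_ h]; apply/eqP => E; rewrite E subrr i0 ltxx in h.
by move=> h; split=> //; apply: inner_gt0; rewrite subr_eq0.
Qed.

Lemma delaunay_time_open : open (delaunay_time w).
Proof.
rewrite openE => s Js.
have ns : (rotation gamma w s).1 != e0 R by case: (delaunay_timeW Js).
have /nbhs_ballP[e /= e0' H] : \forall r \near s, (rotation gamma w r).1 != e0 R.
  by have := open_not_pole; rewrite openE => /(_ s ns).
apply/nbhs_ballP; exists e => // s' ss' r /andP[r1 r2].
have [rs|rs] := boolP (Num.min 0 s <= r <= Num.max 0 s); first exact: Js.
apply: H; rewrite /ball /= in ss' *; apply: le_lt_trans ss'.
move: rs; rewrite negb_and -!ltNge => /orP[|].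
  rewrite lt_min => /andP[r0 rs].
  have s'r : s' <= r by move: r1; rewrite ge_min leNgt r0.
  by rewrite !gtr0_norm ?subr_gt0 ?(le_lt_trans s'r) //; lra.
rewrite gt_max => /andP[r0 rs].
have rs' : r <= s' by move: r2; rewrite le_max leNgt r0.
by rewrite !ltr0_norm ?subr_lt0 ?(lt_le_trans rs) //; lra.
Qed.

End DelaunayFlow.

Lemma delaunay_flow :
  is_flow (@delaunay_domain R) (delaunay_X gamma) delaunay_time (rotation gamma).
Proof.
move=> w Dw; have [Tw _] := Dw; split.
- exact: delaunay_time0.
- exact: rotation0.
- split; [exact: delaunay_time_open|exact: delaunay_time_interval|].
  move=> s Js; split; first exact: delaunay_timeW.
  exact: rotation_derive.
- move=> J c [oJ iJ Jc] J0 c0.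
  have E s : J s -> c s = rotation gamma w s.
    move=> Js; rewrite -c0 -{2}[s]subr0.
    apply: (@delaunay_reparam _ gamma J c id (fun=> 1)) => // r Jr.
    have [[Tc _] D] := Jc _ Jr; split; [exact: Tc|by rewrite scale1r|exact: is_derive_id].
  split=> //; apply: (delaunay_time_sub iJ J0) => s Js.
  by rewrite -E //; case: (Jc _ Js) => -[].
Qed.

(** [Phi] turns the curve into a reparametrised Delaunay curve
    ([kepler_Phi]), hence into a rotation ([delaunay_reparam]).  The rotation
    meets no pole between [0] and [tau], since each intermediate time is a
    value of [tau] at a point of the curve. *)
Lemma kepler_curve (J : set R) (c : R -> phase R) t0 t :
  integral_curve (kepler_neg gamma) (kepler_X gamma) J c -> J t0 -> J t ->
  [/\ is_derive t (1 : R) (tau_along c t0) ((c t).1.1 ^+ 2)^-1,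
      delaunay_time (Phi gamma (c t0)) (tau_along c t0 t) &
      Phi gamma (c t) = rotation gamma (Phi gamma (c t0)) (tau_along c t0 t)].
Proof.
move=> [oJ iJ Jc] Jt0 Jt.
have Kc s (Js : J s) : kepler_neg gamma (c s) := (Jc s Js).1.
have Dc s (Js : J s) : is_derive s (1 : R) c (kepler_X gamma (c s)) := (Jc s Js).2.
have Dtau s : J s -> is_derive s (1 : R) (tau_along c t0) ((c s).1.1 ^+ 2)^-1.
  move=> Js; apply: (is_derive_oriented_integral oJ iJ (f := fun s => ((c s).1.1 ^+ 2)^-1)) => // r Jr.
  have [q0 _] := kepler_neg_pos g0 (Kc _ Jr).
  have Dq := is_derive_fst (is_derive_fst (Dc _ Jr)).
  have q2 : (c r).1.1 * (c r).1.1 != 0 by rewrite gt_eqF // mulr_gt0.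
  exact: (is_derive_cont (is_derive_inv (f := fun s => (c s).1.1 * (c s).1.1) q2
    (is_derive_mul Dq Dq))).
have tau0 : tau_along c t0 t0 = 0 by exact: oriented_integralxx.
have E s : J s -> Phi gamma (c s) = rotation gamma (Phi gamma (c t0)) (tau_along c t0 s).
  move=> Js; rewrite -[tau_along c t0 s]subr0 -tau0.
  apply: (@delaunay_reparam _ gamma J (fun s => Phi gamma (c s)) (tau_along c t0)
    (fun s => ((c s).1.1 ^+ 2)^-1)) => // r Jr; split; last exact: Dtau.
    by have [] := Phi_domain g0 (Kc _ Jr).
  exact: (kepler_Phi g0 oJ iJ Kc Dc).
split; [exact: Dtau| |exact: E].
move=> r rt.
have [||s st <-] := interval_IVT (f := tau_along c t0) (a := t0) (b := t) (v := r) iJ _ Jt0 Jt.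
- by move=> s Js; exact: is_derive_cont (Dtau _ Js).
- by rewrite tau0.
have Js : J s.
  by apply: (iJ (Num.min t0 t) (Num.max t0 t)) => //; case: leP.
rewrite -E //; by case: (Phi_domain g0 (Kc _ Js)).
Qed.

Section KeplerFlow.

Let rate z s : R := (Psi gamma (rotation gamma (Phi gamma z) s)).1.1 ^+ 2.
Definition kepler_clock z : R -> R := clock (rate z).
Definition kepler_time z : set R := kepler_clock z @` delaunay_time (Phi gamma z).
Definition kepler_clock_inv z : R -> R :=
  clock_inv (delaunay_time (Phi gamma z)) (rate z).
(** The Kepler flow is transported from the Delaunay flow, with the time change
    inverted; this gives existence, maximality and uniqueness of its integral
    curves without a theorem on differential equations. *)
Definition kepler_flow_map z t : phase R :=
  Psi gamma (rotation gamma (Phi gamma z) (kepler_clock_inv z t)).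

Variable z : phase R.
Hypothesis Kz : kepler_neg gamma z.
Let w := Phi gamma z.
Let Dw : delaunay_domain w. Proof. exact: Phi_domain. Qed.
Let J := delaunay_time w.
Let oJ : open J. Proof. exact: delaunay_time_open. Qed.
Let iJ : is_interval J. Proof. exact: delaunay_time_interval. Qed.
Let J0 : J 0. Proof. exact: delaunay_time0. Qed.
Let DJ s (Js : J s) : delaunay_domain (rotation gamma w s) := delaunay_timeW Dw Js.

Let rate_pos s : J s -> 0 < rate z s.
Proof.
move=> Js; rewrite exprn_gt0 //.
by have [K _ _ _ _] := Psi_kepler g0 (DJ Js); case: (kepler_neg_pos g0 K).
Qed.

Let rate_smooth k : Ck k J (rate z).
Proof.
apply: (Ck_expf oJ); do 2 apply: (Ck_fst oJ).
apply: (Ck_Psi g0 oJ DJ) => j; exact: Ck_subset (@subsetT _ J) (Ck_rotation gamma w j).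
Qed.

Let rate_cont s : J s -> {for s, continuous (rate z)}.
Proof. exact: (rate_smooth 0). Qed.

Lemma kepler_flow_curve :
  integral_curve (kepler_neg gamma) (kepler_X gamma) (kepler_time z) (kepler_flow_map z).
Proof.
have [oI iI] := clock_range oJ iJ J0 rate_pos rate_cont; split=> // t It.
have [Js E] := clock_invP It.
have [K _ _ _ _] := Psi_kepler g0 (DJ Js); split; first exact: K.
have DS := clock_inv_derive oJ iJ J0 rate_pos rate_cont It.
have Tw : TplusS3 w by case: Dw.
have DP := is_derive_Psi g0 oJ Tw DJ Js.
apply: (is_derive_eq (is_derive_comp DP DS)).
by rewrite scalerA mulVf ?scale1r // gt_eqF // rate_pos.
Qed.

Lemma kepler_flow_start : kepler_time z 0 /\ kepler_flow_map z 0 = z.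
Proof.
have T0 := clock0 (rate z); split; first by exists 0.
rewrite /kepler_flow_map -[X in kepler_clock_inv z X]T0 /kepler_clock_inv.
rewrite (clockK oJ iJ J0 rate_pos rate_cont J0).
by rewrite rotation0 ?PhiK //; case: Dw.
Qed.

(** Along the curve, [kepler_clock z] undoes [tau_along c 0]: the two
    derivatives are [q_0 ^+ 2] and its inverse at the same point. *)
Lemma kepler_flow_max (I : set R) c :
  integral_curve (kepler_neg gamma) (kepler_X gamma) I c -> I 0 -> c 0 = z ->
  forall t, I t -> [/\ kepler_time z t, tau_along c 0 t = kepler_clock_inv z t
    & c t = kepler_flow_map z t].
Proof.
move=> Ic I0 c0 t It; have [oI iI IK] := Ic.
have K s (Is : I s) := kepler_curve Ic I0 Is.
have cE s : I s -> c s = Psi gamma (rotation gamma w (tau_along c 0 s)).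
  move=> Is; have [_ _] := K s Is; rewrite c0 -/w => <-.
  by rewrite PhiK //; exact: (IK s Is).1.
have Jtau s : I s -> J (tau_along c 0 s) by move=> /K [_]; rewrite c0.
have tau0 : tau_along c 0 0 = 0 by exact: oriented_integralxx.
have Dcomp s : I s -> is_derive s (1 : R) (fun s => kepler_clock z (tau_along c 0 s) - s) 0.
  move=> Is; have [D _ _] := K s Is.
  have DT := clock_derive oJ iJ J0 rate_cont (Jtau _ Is).
  have H := is_deriveB (is_derive_comp DT D) (is_derive_id s 1).
  apply: (is_derive_eq H); rewrite /rate -/w -cE // /GRing.scale /= mulVf ?subrr //.
  have [q0 _] := kepler_neg_pos g0 (IK s Is).1.
  by rewrite expf_neq0 // gt_eqF.
have Tt : kepler_clock z (tau_along c 0 t) = t.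
  apply/eqP; rewrite -subr_eq0; apply/eqP.
  rewrite -[RHS](_ : kepler_clock z (tau_along c 0 0) - 0 = 0); last first.
    by rewrite tau0 subr0; exact: clock0.
  exact: (interval_cst (f := fun s => kepler_clock z (tau_along c 0 s) - s) iI Dcomp).
(* So tau_along c 0 t is the Delaunay time with clock reading t. *)
have tauE : tau_along c 0 t = kepler_clock_inv z t.
  rewrite -{2}Tt; apply/esym; exact: (clockK oJ iJ J0 rate_pos rate_cont (Jtau _ It)).
split=> //; first by exists (tau_along c 0 t) => //; exact: Jtau.
by rewrite /kepler_flow_map -tauE -/w cE.
Qed.

Lemma kepler_tau t : kepler_time z t ->
  tau_along (kepler_flow_map z) 0 t = kepler_clock_inv z t.
Proof.
have [T0 F0] := kepler_flow_start.
by move=> It; have [] := kepler_flow_max kepler_flow_curve T0 F0 It.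
Qed.

Lemma kepler_clock_inv_lt s t : kepler_time z s -> kepler_time z t -> s < t ->
  kepler_clock_inv z s < kepler_clock_inv z t.
Proof. exact: (clock_inv_lt oJ iJ J0 rate_pos rate_cont). Qed.

Lemma kepler_clock_invP t : kepler_time z t ->
  delaunay_time w (kepler_clock_inv z t) /\ kepler_clock z (kepler_clock_inv z t) = t.
Proof. exact: clock_invP. Qed.

Lemma kepler_tau_diffeomorphism :
  diffeomorphism (kepler_time z) (delaunay_time w) (tau_along (kepler_flow_map z) 0).
Proof.
have [oI iI] := clock_range oJ iJ J0 rate_pos rate_cont.
split.
- split.
  + by move=> t It; rewrite kepler_tau //; case: (kepler_clock_invP It).
  + move=> t t'; rewrite !inE => It It'; rewrite !kepler_tau // => E.
    by rewrite -(kepler_clock_invP It).2 -(kepler_clock_invP It').2 E.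
  + move=> s Js; exists (kepler_clock z s); first by exists s.
    rewrite kepler_tau; last by exists s.
    exact: (clockK oJ iJ J0 rate_pos rate_cont Js).
- move=> t It; exists (kepler_time z), (kepler_clock_inv z); split.
  + by split.
  + by move=> k; exact: (Ck_clock_inv oJ iJ J0 rate_pos rate_cont rate_smooth).
  + by move=> s Is _; exact: kepler_tau.
- exists (kepler_clock z); split.
    by move=> t It; rewrite kepler_tau //; case: (kepler_clock_invP It).
  move=> s Js; exists J, (kepler_clock z); split=> // k.
  exact: (Ck_clock oJ iJ J0 rate_cont rate_smooth).
Qed.

End KeplerFlow.

Lemma kepler_flow :
  is_flow (kepler_neg gamma) (kepler_X gamma) kepler_time kepler_flow_map.
Proof.
move=> z Kz; have [T0 F0] := kepler_flow_start Kz; split=> //.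
  exact: kepler_flow_curve.
move=> J c Jc J0 c0; have H := kepler_flow_max Kz Jc J0 c0.
by split=> t Jt; have [] := H t Jt.
Qed.

Lemma kepler_delaunay_equivalence :
  smooth_equivalence (kepler_neg gamma) kepler_time kepler_flow_map
    (@delaunay_domain R) delaunay_time (rotation gamma)
    (Phi gamma) (fun z => tau_along (kepler_flow_map z) 0).
Proof.
have conj z t : kepler_neg gamma z -> kepler_time z t ->
    Phi gamma (kepler_flow_map z t) = rotation gamma (Phi gamma z) (kepler_clock_inv z t).
  move=> Kz It; have [Js _] := kepler_clock_invP It.
  exact (PsiK g0 (delaunay_timeW (Phi_domain g0 Kz) Js)).
split; first exact: Phi_diffeomorphism.
- move=> z Kz; apply/seteqP; split=> y /=.
    move=> [_ [t It <-] <-]; exists (kepler_clock_inv z t); last by rewrite conj.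
    by case: (kepler_clock_invP It).
  move=> [s Js <-].
  have [[_ _ /(_ s Js) [t It ts]] _ _] := kepler_tau_diffeomorphism Kz.
  exists (kepler_flow_map z t); first by exists t.
  by rewrite conj // -ts kepler_tau.
- move=> z Kz; split; first exact: kepler_tau_diffeomorphism.
    by move=> s t Is It st; rewrite !kepler_tau //; exact: kepler_clock_inv_lt.
  by move=> t It; rewrite kepler_tau // conj.
Qed.

Lemma cross_turn (c s : R) (u x : 'rV[R]_3) :
  cross (s *: u + c *: x) (- (c *: u) + s *: x) = (c ^+ 2 + s ^+ 2) *: cross u x.
Proof. by apply/rowP => i; rewrite !mxE; ring. Qed.

Lemma crossZr (a : R) (u x : 'rV[R]_3) : cross u (a *: x) = a *: cross u x.
Proof. by apply/rowP => i; rewrite !mxE; ring. Qed.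

(** The bold part of [x] and [y] have the same cross product as those of [q]
    and [v]: rotations of the pair preserve it, and so does the gnomonic
    projection. *)
Lemma mu_Phi z : kepler_neg gamma z -> mu (Phi gamma z) = mu z.
Proof.
move=> Kz; have [q0 _] := kepler_neg_pos g0 Kz; have n0 := nu_gt0 g0 Kz.
have r0 := radius_gt0 g0 Kz.
rewrite /mu /Phi alphaE // betaE // /= crossZr cross_turn cos2Dsin2 scale1r.
move: (nu _ _) (radius _) n0 r0 => n r n0 r0; rewrite /gnomonic /pi_.
move: (dot _ _ / gamma) => k.
case: z q0 {Kz} k => [[a q] [b v]] /= a0 k.
by apply/rowP => i; rewrite !mxE; field; rewrite !gt_eqF.
Qed.

Lemma mu_rotation w s : TplusS3 w -> mu (rotation gamma w s) = mu w.
Proof.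
move=> Tw; have [n0 _ E _] := TplusS3_nu Tw.
rewrite /mu [in RHS]E /rotation /= !(crossZr (Num.sqrt _)); congr (_ *: _).
by rewrite cross_turn addrC cos2Dsin2 scale1r.
Qed.

(** Angular momentum vanishes on great circles through the pole. *)
Lemma no_pole z s : kepler_neg gamma z -> mu z != 0 ->
  (rotation gamma (Phi gamma z) s).1 != e0 R.
Proof.
move=> Kz; apply: contra => /eqP E; have [Tw _] := Phi_domain g0 Kz.
rewrite -mu_Phi // -(mu_rotation s Tw) /mu E; apply/eqP/rowP => i.
by rewrite !mxE !mul0r subrr.
Qed.

Lemma delaunay_time_full z : kepler_neg gamma z -> mu z != 0 ->
  delaunay_time (Phi gamma z) = setT.
Proof.
move=> Kz mz; apply/seteqP; split=> // s _ r _; exact: no_pole.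
Qed.

(** The radius is bounded by [2 * nu ^+ 2 / gamma], so [q_0 ^+ 2] is bounded
    below along the orbit and the clock runs through all of the real line. *)
Lemma kepler_time_full z : kepler_neg gamma z -> mu z != 0 -> kepler_time z = setT.
Proof.
move=> Kz mz; have Dw := Phi_domain g0 Kz; have [Tw _] := Dw.
have JT := delaunay_time_full Kz mz.
have D s : delaunay_domain (rotation gamma (Phi gamma z) s).
  by apply: delaunay_timeW => //; rewrite JT.
set w := Phi gamma z in Dw Tw JT D.
pose n2 := inner w.2 w.2.
have n2_gt0 : 0 < n2 by apply: inner_gt0; case: Tw.
pose f s := (Psi gamma (rotation gamma w s)).1.1 ^+ 2.
(* The radius n2 * (1 - beta_0) / gamma is at most 2 * n2 / gamma, as beta_0 >= -1. *)
pose d := (1 + (2 * n2 / gamma) ^+ 2)^-1.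
have d0 : 0 < d by rewrite invr_gt0 ltr_pwDl // sqr_ge0.
have fd s : d <= f s.
  have [K _ rE _ _] := Psi_kepler g0 (D s).
  have := radius_sqr g0 K; rewrite rE => /(congr1 GRing.inv); rewrite invrK /f => <-.
  have r0 := Psi_radius_gt0 g0 (D s).
  have rb : Psi_radius gamma (rotation gamma w s) <= 2 * n2 / gamma.
    rewrite /Psi_radius rotation_inner // -/n2 ler_pM2r ?invr_gt0 // [leRHS]mulrC ler_pM2l //.
    have [_ bb _] := Psi_dots (D s).
    have := dot_ge0 (Psi_beta (rotation gamma w s)).2; rewrite bb => h; nra.
  by rewrite /d lef_pV2 ?posrE ?ltr_pwDl ?sqr_ge0 // lerD2l ler_sqr ?nnegrE ?(ltW r0) //
     (le_trans (ltW r0) rb).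
have fc s : setT s -> {for s, continuous f}.
  move=> _; have c : Ck 0 setT f.
    apply: (Ck_expf openT); do 2 apply: (Ck_fst openT).
    by apply: (Ck_Psi g0 openT) => [x _|k]; [exact: D|exact: Ck_rotation].
  exact: c.
have iT : is_interval [set: R] by [].
have DT s : setT s -> is_derive s (1 : R) (kepler_clock z) (f s).
  by move=> _; apply: (clock_derive openT iT).
have T0 : kepler_clock z 0 = 0 by exact: clock0.
apply/seteqP; split=> // t _; rewrite /kepler_time JT.
have big x : 0 < x -> d * x <= kepler_clock z x.
  move=> x0; have [c _] := interval_MVT iT DT (Logic.I : setT 0) (Logic.I : setT x) x0.
  by rewrite T0 !subr0 => ->; rewrite ler_pM2r.
have small x : x < 0 -> kepler_clock z x <= d * x.
  move=> x0; have [c _] := interval_MVT iT DT (Logic.I : setT x) (Logic.I : setT 0) x0.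
  rewrite T0 !sub0r => /(canRL (@opprK R)) ->; rewrite mulrN opprK ler_nM2r //.
have Tc s : setT s -> {for s, continuous (kepler_clock z)}.
  by move=> h; exact: is_derive_cont (DT s h).
have ivt x : Num.min 0 (kepler_clock z x) <= t <= Num.max 0 (kepler_clock z x) ->
    (kepler_clock z @` setT) t.
  rewrite -T0 => h; have [s _ <-] := interval_IVT iT Tc (Logic.I : setT 0) (Logic.I : setT x) h.
  by exists s.
have [t0|t0|->] := ltgtP t 0; last by exists 0.
- apply: (ivt (t / d)); have := small (t / d).
  rewrite mulrCA mulfV ?gt_eqF // mulr1 ltr_pdivrMr // mul0r => /(_ t0) h.
  by rewrite ge_min le_max h (ltW t0) !orbT.
- apply: (ivt (t / d)); have := big (t / d).
  rewrite mulrCA mulfV ?gt_eqF // mulr1 divr_gt0 // => /(_ isT) h.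
  by rewrite ge_min le_max h (ltW t0) !orbT.
Qed.

End Flows.

Theorem theorem5p7 (R : realType) (gamma : R) (gamma_gt0 : 0 < gamma) :
  exists (DX : phase R -> set R) (gX : phase R -> R -> phase R)
         (DY : phase R -> set R) (gY : phase R -> R -> phase R),
    [/\ is_flow (kepler_neg gamma) (kepler_X gamma) DX gX,
        is_flow (@delaunay_domain R) (delaunay_X gamma) DY gY,
        smooth_equivalence (kepler_neg gamma) DX gX
          (@delaunay_domain R) DY gY
          (Phi gamma) (fun z => tau_along (gX z) 0),
        forall (J : set R) (c : R -> phase R) (t0 t : R),
          integral_curve (kepler_neg gamma) (kepler_X gamma) J c ->
          J t0 -> J t ->
          DY (Phi gamma (c t0)) (tau_along c t0 t) /\
          Phi gamma (c t) = gY (Phi gamma (c t0)) (tau_along c t0 t) &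
        forall z, kepler_neg gamma z -> mu z != 0 ->
          DX z = setT /\ DY (Phi gamma z) = setT].
Proof.
exists (kepler_time gamma), (kepler_flow_map gamma), (delaunay_time gamma), (rotation gamma).
split.
- exact: kepler_flow.
- exact: delaunay_flow.
- exact: kepler_delaunay_equivalence.
- by move=> J c t0 t Jc Jt0 Jt; have [] := kepler_curve gamma_gt0 Jc Jt0 Jt.
- by move=> z Kz mz; split; [exact: kepler_time_full|exact: delaunay_time_full].
Qed.
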